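(* Let $(M,d)$ be a nonempty compact metric space, let $\Phi$ be a set-valued dynamical system on $M$, let $(\Omega,\mathcal{F},\mathbb{P})$ be a probability space with a nondecreasing family $(\mathcal{F}_t)_{t\ge 0}$ of sub-$\sigma$-algebras of $\mathcal{F}$, and let $\mathbf{X}:\mathbb{R}_+\times\Omega\to M$ be a weak asymptotic pseudotrajectory for $\Phi$. For $t>0$ and $\omega\in\Omega$ let $$\mu_t(\omega):=\frac1t\int_0^t\delta_{\mathbf{X}(s,\omega)}\,ds$$ be the empirical occupation measure, and let $\mathcal{P}_{(\mathbf{X},\omega)}\subset\mathcal{P}(M)$ be the set of weak$^*$ limit points of $\mu_t(\omega)$ as $t\to\infty$. Then $$\mathcal{P}_{(\mathbf{X},\omega)}\subset\mathcal{P}_\Phi\quad\text{for almost every }\omega,$$ where $\mathcal{P}_\Phi$ is the set of invariant measures for $\Phi$. In particular, $$\bigcup_{\mu\in\mathcal{P}_{(\mathbf{X},\omega)}}\operatorname{supp}(\mu)\subset \mathrm{BC}(\Phi)\quad\text{for almost every }\omega,$$ where $\mathrm{BC}(\Phi)$ is the Birkhoff center of $\Phi$.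
   Context: For nonempty closed sets $A,B$ put $d_H(A,B):=\sup_{a\in A}d(a,B)$; the Hausdorff distance is $\max\{d_H(A,B),d_H(B,A)\}$. A set-valued dynamical system (SVDS) on $M$ is a map $\Phi$ assigning to each $(t,x)\in\mathbb{R}_+\times M$ a nonempty closed set $\Phi_t(x)\subset M$ such that: (a) $\Phi_0(x)=\{x\}$ for all $x$; (b) $\Phi_t(\Phi_s(x))=\Phi_{t+s}(x)$ for all $x$ and $s,t\ge0$, where $\Phi_t(A)=\bigcup_{a\in A}\Phi_t(a)$; (c) for each $x$, $t\mapsto\Phi_t(x)$ is continuous for the Hausdorff distance; (d) for each $t$, $x\mapsto\Phi_t(x)$ is upper semicontinuous: for all $x_0\in M$, $\varepsilon>0$ there is $\delta>0$ with $d_H(\Phi_t(x),\Phi_t(x_0))<\varepsilon$ for all $x\in B(x_0,\delta)$. An entire solution of $\Phi$ is a function $\mathbf{z}:\mathbb{R}\to M$ with $\mathbf{z}(t)\in\Phi_{t-s}(\mathbf{z}(s))$ for all $s\le t$ in $\mathbb{R}$ (such functions are continuous). $S_\Phi$ is the set of entire solutions and $S_\Phi(x)=\{\mathbf{z}\in S_\Phi:\mathbf{z}(0)=x\}$. $\mathcal{C}(\mathbb{R},M)$ carries the topology of uniform convergence on compact sets; $\Theta_t(\mathbf{y})(s)=\mathbf{y}(t+s)$ is the translation flow on it ($t\in\mathbb{R}$) and $\pi_0(\mathbf{y})=\mathbf{y}(0)$. For a Borel map $f$, $f^*(\nu)$ denotes the push-forward $f^*(\nu)(A)=\nu(f^{-1}(A))$.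 $\mathcal{P}(\cdot)$ denotes the Borel probability measures, and $\operatorname{supp}$ the support. A measure $\mu\in\mathcal{P}(M)$ is an invariant measure for $\Phi$ if there is a $\Theta$-invariant Borel probability measure $\nu$ on $S_\Phi$ with $\pi_0^*(\nu)=\mu$; $\mathcal{P}_\Phi$ is the set of such $\mu$. For $\mathbf{z}\in S_\Phi$ let $L(\mathbf{z})=\bigcap_{t\ge0}\overline{\mathbf{z}([t,\infty))}$, and $L(x)=\bigcup_{\mathbf{z}\in S_\Phi(x)}L(\mathbf{z})$. The set of recurrent points is $R_\Phi=\{x\in M: x\in L(x)\}$, and $\mathrm{BC}(\Phi)=\overline{R_\Phi}$. A process $\mathbf{X}:\mathbb{R}_+\times\Omega\to M$ is a weak asymptotic pseudotrajectory (WAPT) for $\Phi$ if: (i) for almost every $\omega$ the path $\mathbf{X}(\cdot,\omega)$ is uniformly continuous; (ii) it is progressively measurable: $\mathbf{X}|_{[0,T]\times\Omega}$ is $\mathcal{B}_{[0,T]}\times\mathcal{F}_T$-measurable for all $T>0$; (iii) for each $\alpha>0$ and $T>0$, $$\lim_{t\to\infty}\mathbb{P}\Big(\inf_{\mathbf{z}\in S_\Phi}\sup_{s\in[0,T]}d(\mathbf{X}(t+s),\mathbf{z}(s))\ge\alpha\,\Big|\,\mathcal{F}_t\Big)=0\quad\text{almost surely.}$$ *)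

(* Defs.v *)
From HB Require Import structures.
From mathcomp Require Import all_boot all_order all_algebra.
From mathcomp Require Import all_classical all_reals all_analysis.

Set Implicit Arguments.
Unset Strict Implicit.
Unset Printing Implicit Defensive.

Import Order.TTheory GRing.Theory Num.Theory.
Import numFieldNormedType.Exports.

Local Open Scope classical_set_scope.
Local Open Scope ring_scope.

(* Nonempty metric spaces; the base point is only there because
   measurableType requires one. *)
#[short(type="pmetricType")]
HB.structure Definition PointedMetric (K : numDomainType) :=
  {M of Metric K M & Pointed M}.

Notation borel T := (g_sigma_algebraType (@open T)).

(* Functions of a time in R_+ are represented by functions on R that are only
   constrained and used at nonnegative times. *)

Section set_valued_dynamics.
Context {R : realType} {M : pmetricType R}.
Implicit Types (Phi : R -> M -> set M) (A B : set M) (x : M).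

Definition excess A B : \bar R :=
  ereal_sup [set ereal_inf [set (mdist a b)%:E | b in B] | a in A].

Definition hausdorff_dist A B : \bar R := maxe (excess A B) (excess B A).

Record is_svds Phi : Prop := IsSVDS {
  svds_nonempty : forall (t : R) x, 0 <= t -> Phi t x !=set0;
  svds_closed : forall (t : R) x, 0 <= t -> closed (Phi t x);
  svds_init : forall x, Phi 0 x = [set x];
  svds_semigroup : forall (s t : R) x, 0 <= s -> 0 <= t ->
    \bigcup_(y in Phi s x) Phi t y = Phi (t + s) x;
  svds_continuous_time : forall x (t : R), 0 <= t -> forall e : R, 0 < e ->
    exists2 delta : R, 0 < delta & forall s : R, 0 <= s -> `|s - t| < delta ->
      (hausdorff_dist (Phi s x) (Phi t x) < e%:E)%E;
  svds_usc : forall (t : R) x0, 0 <= t -> forall e : R, 0 < e ->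
    exists2 delta : R, 0 < delta & forall x, ball x0 delta x ->
      (excess (Phi t x) (Phi t x0) < e%:E)%E }.

(* Entire solutions of a set-valued dynamical system are continuous, so the
   topology induced on this set by {family compact, R -> M} is the one induced
   by C(R, M) with uniform convergence on compact sets. *)
Definition entire_solutions Phi : set {family compact, R -> M} :=
  [set z | forall s t : R, s <= t -> Phi (t - s) (z s) (z t)].

Definition translation (t : R) (y : {family compact, R -> M}) :
  {family compact, R -> M} := fun s => y (t + s).

Lemma translation_entire Phi t z :
  entire_solutions Phi z -> entire_solutions Phi (translation t z).
Proof.
move=> zP s u su; rewrite /translation.
have -> : u - s = (t + u) - (t + s) by rewrite opprD addrACA subrr add0r.
by apply: zP; rewrite lerD2l.
Qed.

Definition solution_translation Phi (t : R) (z : entire_solutions Phi) :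
    entire_solutions Phi :=
  SigSub (mem_set (translation_entire t (set_mem (valP z)))).

Definition limit_set (z : R -> M) : set M :=
  \bigcap_(t in [set t : R | 0 <= t]) closure (z @` [set s : R | t <= s]).

Definition limit_set_from Phi x : set M :=
  \bigcup_(z in [set z | entire_solutions Phi z /\ z 0 = x]) limit_set z.

Definition recurrent_points Phi : set M := [set x | limit_set_from Phi x x].

Definition birkhoff_center Phi : set M := closure (recurrent_points Phi).

Definition measure_support (mu : set (borel M) -> \bar R) : set M :=
  [set x | forall U : set M, open U -> U x -> (0 < mu U)%E].

End set_valued_dynamics.

(* T with a chosen base point. *)
Definition pointed_at {T : Type} (x0 : T) : Type := T.
HB.instance Definition _ (T : topologicalType) (x0 : T) :=
  Topological.copy (pointed_at x0) T.
HB.instance Definition _ (T : topologicalType) (x0 : T) :=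
  isPointed.Build (pointed_at x0) x0.

(* measurableType requires a base point, hence z0; its existence is no
   restriction since a probability measure lives on a nonempty space. *)
Definition invariant_measures {R : realType} {M : pmetricType R}
    (Phi : R -> M -> set M) : set (probability (borel M) R) :=
  [set mu | exists (z0 : entire_solutions Phi)
                   (nu : probability (borel (pointed_at z0)) R),
     (forall (t : R) (A : set (borel (pointed_at z0))), measurable A ->
        nu (solution_translation t @^-1` A) = nu A) /\
     (forall A : set (borel M), measurable A ->
        mu A = nu [set z : entire_solutions Phi | A (set_val z 0)])].

Section occupation_measures.
Context {R : realType} {M : pmetricType R}.

Definition occupation_measure (x : R -> M) (t : R) : set (borel M) -> \bar R :=
  fun A => ((t^-1)%:E *
    \int[lebesgue_measure]_(s in `[0%R, t]) dirac (x s : borel M) A)%E.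

(* The weak* topology is that of pointwise convergence on C(M, R) of the
   functionals f |-> \int f dm. *)
Definition integral_functional (m : set (borel M) -> \bar R) :
    {ptws continuousType M R -> R} :=
  fun f => fine (\int[m]_(y in setT) (f y)%:E)%E.

Definition occupation_limits (x : R -> M) : set (probability (borel M) R) :=
  [set mu | cluster
     (integral_functional (occupation_measure x t) @[t --> +oo])
     (integral_functional mu)].

End occupation_measures.

Section weak_asymptotic_pseudotrajectories.
Context {R : realType} {M : pmetricType R} {d : measure_display}
  {Omega : measurableType d}.
Variables (P : probability Omega R) (F : R -> set (set Omega)).

Record is_filtration : Prop := IsFiltration {
  filtration_sigma_algebra : forall t : R, 0 <= t -> sigma_algebra setT (F t);
  filtration_measurable : forall t : R, 0 <= t -> F t `<=` measurable;
  filtration_nondecreasing : forall s t : R, 0 <= s -> s <= t -> F s `<=` F t }.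

(* p is a version of P(A | G).  The event A is only required to be measurable
   up to a P-negligible set: an event defined from the whole path of a process
   whose paths are continuous almost surely need not be measurable itself. *)
Definition cond_prob_version (G : set (set Omega)) (A : set Omega)
    (p : Omega -> R) : Prop :=
  [/\ measurable_fun [set: g_sigma_algebraType G] (p : g_sigma_algebraType G -> R),
      P.-integrable setT (EFin \o p) &
      exists B : set Omega,
        [/\ measurable B, P.-negligible ((A `\` B) `|` (B `\` A)) &
            forall H, G H ->
              (\int[P]_(w in H) (p w)%:E = P (B `&` H))%E]].

Definition dist_to_solutions (Phi : R -> M -> set M) (T : R) (y : R -> M) :
    \bar R :=
  ereal_inf [set ereal_sup [set (mdist (y s) (z s))%:E | s in `[0, T]]
            | z in entire_solutions Phi].

(* A conditional probability is only defined up to a null set for each t, so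
   the almost sure limit over t is understood for some choice of versions. *)
Record is_wapt (Phi : R -> M -> set M) (X : R -> Omega -> M) : Prop := IsWAPT {
  wapt_uniformly_continuous : {ae P, forall w, forall e : R, 0 < e ->
    exists2 delta : R, 0 < delta & forall s t : R, 0 <= s -> 0 <= t ->
      `|s - t| < delta -> mdist (X s w) (X t w) < e};
  wapt_progressive : forall T : R, 0 < T ->
    measurable_fun
      (`[0, T] `*` setT : set (measurableTypeR R * g_sigma_algebraType (F T)))
      (fun sw => X sw.1 sw.2 : borel M);
  wapt_asymptotic : forall alpha T : R, 0 < alpha -> 0 < T ->
    exists2 p : R -> Omega -> R,
      forall t : R, 0 <= t -> cond_prob_version (F t)
        [set w | (alpha%:E <=
                  dist_to_solutions Phi T (fun s => X (t + s)%R w))%E] (p t) &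
      {ae P, forall w, p t w @[t --> +oo] --> (0 : R)} }.

End weak_asymptotic_pseudotrajectories.

(* Main.v *)
Require Import Defs.
From HB Require Import structures.
From mathcomp Require Import all_boot all_order all_algebra.
From mathcomp Require Import all_classical all_reals all_analysis.
From mathcomp Require Import measurable_realfun finmap ring lra.

(** Almost surely the path x = X(., w) is uniformly continuous and is close
    to entire solutions on most time windows; everything else is
    deterministic, path by path.

    The probabilistic part works on grids of times k/(m+1).  Split a grid into
    arithmetic progressions whose step is the window length T.  Along such a
    progression, the event that no solution is close on the window starting at
    the i-th time is known at the next time, and its conditional probability
    given the past is eventually below any eps.  Restrict these events to the
    times at which it is.  The probability that at least j of the first n
    restricted events occur is at most C(n, j) eps^j, by the recursion of
    Pascal's triangle; for eps = 4^-l and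
    j > n/l this is below 2^-n, and the Borel-Cantelli lemma shows that the
    bad times have density zero in the grid (occurrences_negligible,
    wapt_shadowed).  Sampling on grids matters here: the versions of the
    conditional probabilities at different times are chosen independently, so
    that integrating them over t would make no sense.

    For the deterministic part, take a weak* limit point mu and an ultrafilter
    of times along which the occupation measures converge to mu.  The iterated
    ultralimit of grid frequencies, first over long times and then over fine
    grids, is a finitely additive density on all sets of times, invariant
    under translation up to small enlargements (time_density_translate).
    Choose, for every time r, an entire solution z_r that tracks the path near
    r as well as possible; since this choice need not be measurable in r, it is
    important that the density measures all sets.  Transporting the density by
    z gives a finitely additive probability on all subsets of the space of
    entire solutions.  This space is compact, so a
    Caratheodory construction turns the content into a Borel probability nu
    that is larger on closed sets and smaller on open sets
    (regular_probability_of_content).  Sandwiching with these inequalities,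
    nu is invariant under translation, because the solution z_r translated by
    u is close to z_{r+u}, and its image under evaluation at time zero is mu,
    because z_r(0) is close to x(r).

    Compactness of the space of entire solutions rests on their
    equicontinuity: Phi_t(x) is close to x for small t uniformly in x.  The
    axioms give continuity in t and semicontinuity in x only separately, and
    the joint statement comes from the Baire category theorem
    (svds_separate).

    Finally, the Poincare recurrence theorem applied to nu shows that almost
    every entire solution starts at a recurrent point, hence every open set of
    positive mu-measure contains recurrent points. *)

Set Implicit Arguments.
Unset Strict Implicit.
Unset Printing Implicit Defensive.

Import Order.TTheory GRing.Theory Num.Theory.
Import numFieldNormedType.Exports.

Local Open Scope classical_set_scope.
Local Open Scope ring_scope.

(** * Continuity of set-valued dynamical systems *)

Section metric_facts.
Context {R : realType} {M : metricType R}.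
Implicit Types x y z : M.

Lemma ler_mdistB x y z : `|mdist x y - mdist x z| <= mdist y z.
Proof.
rewrite ler_norml; apply/andP; split.
  rewrite lerNl opprB lerBlDr addrC; exact: metric_triangle.
rewrite lerBlDr addrC (metric_sym y z); exact: metric_triangle.
Qed.

Lemma mdist_continuous x : continuous (mdist x).
Proof.
move=> y; apply/cvgrPdist_lt => e e0.
have : nbhs y (ball y e) by exact: nbhsx_ballx.
apply: filterS => z; rewrite ballEmdist /=; apply: le_lt_trans.
exact: ler_mdistB.
Qed.

Lemma closed_mdist_le x r : closed [set y | mdist x y <= r].
Proof.
by apply: (closed_comp (D := [set z | z <= r])) => [y _|];
  [exact: mdist_continuous|exact: closed_le].
Qed.

Lemma open_mdist_lt x r : open [set y | mdist x y < r].
Proof.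
by apply: (open_comp (D := [set z | z < r])) => [y _|];
  [exact: mdist_continuous|exact: open_lt].
Qed.

End metric_facts.

Lemma excess_lt_ex {R : realType} {M : pmetricType R} (A B : set M) (e : R) a :
  (excess A B < e%:E)%E -> A a -> exists2 b, B b & mdist a b < e.
Proof.
move=> AB Aa.
have : (ereal_inf [set (mdist a b)%:E | b in B] < e%:E)%E.
  by apply: le_lt_trans AB; apply: ereal_sup_ubound; exists a.
by move=> /ereal_inf_lt[_ [b Bb <-]]; rewrite lte_fin => be; exists b.
Qed.

Section svds.
Context {R : realType} {M : pmetricType R}.
Variables (Phi : R -> M -> set M).
Hypotheses (M_compact : compact [set: M]) (PhiP : is_svds Phi).

Lemma svds_time_dist x (t e : R) : 0 <= t -> 0 < e ->
  exists2 delta : R, 0 < delta & forall s : R, 0 <= s -> `|s - t| < delta ->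
    (forall y, Phi s x y -> exists2 z, Phi t x z & mdist y z < e) /\
    (forall y, Phi t x y -> exists2 z, Phi s x z & mdist y z < e).
Proof.
move=> t0 e0; have [delta d0 H] := svds_continuous_time PhiP x t0 e0.
exists delta => // s s0 st; have := H s s0 st.
rewrite /hausdorff_dist gt_max => /andP[H1 H2].
by split=> y; exact: excess_lt_ex.
Qed.

Lemma svds_point_dist (t e : R) x0 : 0 <= t -> 0 < e ->
  exists2 delta : R, 0 < delta & forall x, mdist x0 x < delta ->
    forall y, Phi t x y -> exists2 z, Phi t x0 z & mdist y z < e.
Proof.
move=> t0 e0; have [delta d0 H] := svds_usc PhiP x0 t0 e0.
exists delta => // x x0x y; apply: excess_lt_ex; apply: H.
by rewrite ballEmdist.
Qed.

(** If Phi_s(x) is contained in C for times s arbitrarily close to t then so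
    is Phi_t(x), since every point of Phi_t(x) is a limit of points of
    Phi_s(x). *)
Lemma closed_svds_times (C : set M) x : closed C ->
  closed [set t : R | 0 <= t /\ Phi t x `<=` C].
Proof.
move=> cC t tcl.
have t0 : 0 <= t.
  have : closure [set t : R | 0 <= t] t.
    by move: tcl; apply: closureS => s [].
  by rewrite -(closure_id _).1//; exact: closed_ge.
split => // w Phiw; apply: cC => B /nbhs_ballP[e /= e0 eB].
have [delta d0 H] := svds_time_dist x t0 e0.
have [s [[s0 sC] ts]] : [set t : R | 0 <= t /\ Phi t x `<=` C] `&` ball t delta !=set0.
  by apply: tcl; exact: nbhsx_ballx.
have [|_ /(_ _ Phiw)[z Phiz wz]] := H s s0; first by rewrite distrC.
by exists z; split; [exact: sC|apply: eB; rewrite ballEmdist].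
Qed.

Lemma svds_initial_dist x (e : R) : 0 < e ->
  exists2 delta : R, 0 < delta & forall s y, 0 <= s -> s < delta ->
    Phi s x y -> mdist x y < e.
Proof.
move=> e0; have [delta d0 H] := svds_time_dist x (lexx 0) e0.
exists delta => // s y s0 sd Phiy.
have [|/(_ _ Phiy)[z + yz] _] := H s s0; first by rewrite subr0 ger0_norm.
by rewrite (svds_init PhiP) /= metric_sym => <-.
Qed.

(** Suppose that points x_n near x reach points y_n near y within times s_n
    tending to 0. For a fixed small t, semicontinuity puts Phi_t(x_n) near x
    and Phi_t(y_n) near y for all large n, but how large depends on t; the
    Baire category theorem makes n uniform on an interval of times. For t in
    that interval, Phi_t(y_n) is contained in Phi_{t + s_n}(x_n), so that it
    is both near x and near y. *)
Lemma svds_separate x y : x != y -> exists2 delta : R, 0 < delta &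
  forall s x' y', 0 <= s -> s < delta -> mdist x x' < delta ->
    mdist y y' < delta -> ~ Phi s x' y'.
Proof.
move=> xy; apply: contrapT => nsep.
have sep n : exists uvs : M * M * R, [/\ 0 <= uvs.2 < n.+1%:R^-1,
    mdist x uvs.1.1 < n.+1%:R^-1, mdist y uvs.1.2 < n.+1%:R^-1 &
    Phi uvs.2 uvs.1.1 uvs.1.2].
  apply: contrapT => H; apply: nsep; exists n.+1%:R^-1 => // s x' y' s0 sn xx' yy' Phi'.
  by apply: H; exists (x', y', s); split => //=; apply/andP.
have [uvs {sep nsep}] := choice sep.
pose u n := (uvs n).1.1; pose v n := (uvs n).1.2; pose s n := (uvs n).2.
move=> sep.
have {sep}[sP uP vP PhiP'] : [/\ (forall n, 0 <= s n < n.+1%:R^-1),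
    (forall n, mdist x (u n) < n.+1%:R^-1),
    (forall n, mdist y (v n) < n.+1%:R^-1) &
    forall n, Phi (s n) (u n) (v n)].
  by split=> n; case: (sep n).
(* Any fraction below 1/4 leaves room for the two closed balls of radius 2 eta. *)
pose eta := mdist x y / 8.
have eta0 : 0 < eta by rewrite divr_gt0// mdist_gt0.
have xy_eta : mdist x y = 8 * eta by rewrite /eta; field.
have [dx dx0 xP] := svds_initial_dist x eta0.
have [dy dy0 yP] := svds_initial_dist y eta0.
pose t0 := Num.min dx dy.
have t00 : 0 < t0 by rewrite lt_min dx0.
pose C (w : M) := [set z : M | mdist w z <= 2 * eta].
pose E N := \bigcap_(n in [set n | (N <= n)%N])
  ([set t : R | 0 <= t /\ Phi t (u n) `<=` C x] `&`
   [set t : R | 0 <= t /\ Phi t (v n) `<=` C y]).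
have cE N : closed (E N).
  by apply: closed_bigI => n _; apply: closedI; apply: closed_svds_times;
    exact: closed_mdist_le.
have invn_lt (e : R) : 0 < e -> \forall n \near \oo, n.+1%:R^-1 < e.
  by move=> e0; exact: near_infty_natSinv_lt (PosNum e0).
(* Semicontinuity at x and at y, for a fixed duration t. *)
have Ecover t : 0 < t < t0 -> exists N, E N t.
  move=> /andP[tgt0]; rewrite lt_min => /andP[tx ty].
  have [ex ex0 xU] := svds_point_dist x (ltW tgt0) eta0.
  have [ey ey0 yU] := svds_point_dist y (ltW tgt0) eta0.
  have [N _ NP] := filterI (invn_lt _ ex0) (invn_lt _ ey0).
  exists N => n Nn; have /= [nex ney] := NP n Nn; split; (split; first exact: ltW).
    move=> w /(xU _ (lt_trans (uP n) nex))[z /(xP _ _ (ltW tgt0) tx) xz wz].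
    rewrite /C /=; have := metric_triangle x z w; rewrite (metric_sym z w); lra.
  move=> w /(yU _ (lt_trans (vP n) ney))[z /(yP _ _ (ltW tgt0) ty) xz wz].
  rewrite /C /=; have := metric_triangle y z w; rewrite (metric_sym z w); lra.
have [N nd] : exists N, ~ dense (~` E N).
  apply: contrapT => /forallNP nd.
  have : dense (\bigcap_N (~` E N)).
    apply: (@Baire _ R^o) => N; split; first exact: closed_openC.
    by apply: contrapT; exact: nd.
  move=> /(_ `]0, t0[%classic)[| |t []].
  - by exists (t0 / 2); rewrite /= in_itv/=; apply/andP; split; lra.
  - exact: interval_open.
  - by rewrite /= in_itv/= => /Ecover[N EN] /(_ N I); exact.
have {nd}[a [e e0 aE]] : exists a, exists2 e : R, 0 < e & ball a e `<=` E N.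
  move: nd => /existsNP[U]; rewrite not_implyP => -[[a Ua]].
  rewrite not_implyP => -[oU UE]; exists a.
  have /nbhs_ballP[e /= e0 eU] : nbhs a U by exact: open_nbhs_nbhs.
  exists e => // b /eU Ub; apply: contrapT => nEb; apply: UE.
  by exists b.
have [k _ kP] := invn_lt _ e0.
pose n := maxn k N.
have [sn0 sne] : 0 <= s n /\ s n < e.
  have /andP[-> sn] := sP n; split => //; apply: (lt_trans sn).
  exact: (kP n (leq_maxl _ _)).
have Nn : (N <= n)%N by exact: leq_maxr.
have asn : ball a e (a + s n).
  by rewrite /ball/= opprD addrA subrr sub0r normrN ger0_norm.
have [[_ Pu] _] := aE _ asn n Nn.
have [_ [a0 Pv]] := aE a (ballxx _ e0) n Nn.
have [w Phiw] := svds_nonempty PhiP (v n) a0.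
have yw := Pv _ Phiw.
have xw : C x w.
  apply: Pu; rewrite -(svds_semigroup PhiP)//; by exists (v n).
move: xw yw; rewrite /C /= => xw yw.
have := metric_triangle x w y; rewrite (metric_sym w y); lra.
Qed.

(** The separation of distinct points becomes uniform by compactness of the
    product of M with itself. *)
Lemma svds_small_time (e : R) : 0 < e ->
  exists2 delta : R, 0 < delta & forall s x y, 0 <= s -> s < delta ->
    Phi s x y -> mdist x y < e.
Proof.
move=> e0; apply: contrapT => nsmall.
have small n : exists uvs : M * M * R, [/\ 0 <= uvs.2 < n.+1%:R^-1,
    Phi uvs.2 uvs.1.1 uvs.1.2 & e <= mdist uvs.1.1 uvs.1.2].
  apply: contrapT => H; apply: nsmall; exists n.+1%:R^-1 => // s x y s0 sn Phixy.
  rewrite ltNge; apply/negP => exy; apply: H.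
  by exists (x, y, s); split => //=; apply/andP.
have [uvs {nsmall small} uvsP] := choice small.
have MM : compact [set: M * M].
  by rewrite -setXTT; exact: compact_setX.
have [[x y] [_ xyP]] := MM ((fun n => (uvs n).1) @ \oo) _ filterT.
have near_xy (r : R) : 0 < r -> exists n, [/\ n.+1%:R^-1 < r,
    mdist x (uvs n).1.1 < r & mdist y (uvs n).1.2 < r].
  move=> r0; have [] := xyP [set (uvs n).1 | n in [set n | n.+1%:R^-1 < r]]
    ([set z | mdist x z < r] `*` [set z | mdist y z < r]).
  - apply: filterS (near_infty_natSinv_lt (PosNum r0)) => n nr; by exists n.
  - exists ([set z | mdist x z < r], [set z | mdist y z < r]) => //; split;
      by rewrite /= -ballEmdist; exact: nbhsx_ballx.
  - by move=> _ [[n nr <-] [? ?]]; exists n.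
have xy : x != y.
  apply/eqP => xy; have e20 : 0 < e / 2 by rewrite divr_gt0.
  have [n [_ xn yn]] := near_xy _ e20; have [_ _] := uvsP n.
  have := metric_triangle (uvs n).1.1 x (uvs n).1.2.
  rewrite (metric_sym _ x); rewrite -xy in yn; lra.
have [delta d0 sep] := svds_separate xy.
have [n [nd xn yn]] := near_xy _ d0.
have [/andP[s0 sn] Phin _] := uvsP n.
exact: (sep _ _ _ s0 (lt_trans sn nd) xn yn Phin).
Qed.

End svds.

(** * The space of entire solutions *)

Section entire_solutions.
Context {R : realType} {M : pmetricType R}.
Variables (Phi : R -> M -> set M).
Hypotheses (M_compact : compact [set: M]) (PhiP : is_svds Phi).
Notation S := (entire_solutions Phi).

Lemma entourage_mdist_lt (e : R) : 0 < e ->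
  entourage [set xy : M * M | mdist xy.1 xy.2 < e].
Proof.
move=> e0; have := @entourage_ball _ M (PosNum e0).
by apply: filterS => -[x y]; rewrite /= ballEmdist.
Qed.

Lemma mdist_lt_sub_entourage (E : set (M * M)) : entourage E ->
  exists2 e : R, 0 < e & forall x y, mdist x y < e -> E (x, y).
Proof.
rewrite -entourage_ballE => -[e /= e0 eE]; exists e => // x y xy.
by apply: eE => /=; rewrite ballEmdist.
Qed.

(** The entourages of uniform convergence on compact sets, with all of the
    compact set and the precision explicit. *)
Definition uniformly_near (T e : R) (y : R -> M) : set (R -> M) :=
  [set z | forall s, `|s| <= T -> mdist (y s) (z s) < e].

Lemma nbhs_uniformly_near (T e : R) (y : {family compact, R -> M}) : 0 < e ->
  nbhs y (uniformly_near T e y).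
Proof.
move=> e0; have cT : compact (`[- T, T]%classic : set R) by exact: segment_compact.
have := fam_nbhs y (entourage_mdist_lt e0) cT.
by apply: filterS => z /= yz s sT; apply: yz; rewrite in_itv/= -ler_norml.
Qed.

Lemma uniformly_near_nbhs (y : {family compact, R -> M}) G : nbhs y G ->
  exists T e : R, 0 < e /\ uniformly_near T e y `<=` G.
Proof.
pose F : set_system (R -> M) := filter_from [set Te : R * R | 0 < Te.2]
  (fun Te => uniformly_near Te.1 Te.2 y).
have FF : Filter F.
  apply: filter_from_filter; first by exists (0, 1) => /=.
  move=> [T e] [T' e'] /= e0 e'0; exists (Num.max T T', Num.min e e') => /=.
    by rewrite lt_min e0.
  by move=> z zy; split => s sT; (apply: (lt_le_trans (zy s _));
    [by rewrite /= le_max sT ?orbT|by rewrite /= ge_min lexx ?orbT]).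
have Fy : {family compact, F --> y}.
  apply/fam_cvgP => K cK G' /uniform_nbhs[E [entE EG]].
  have [e e0 eE] := mdist_lt_sub_entourage entE.
  have /= [T [_ KT]] := compact_bounded cK.
  exists (T + 1, e) => //= z zy; apply: EG => s Ks; apply: eE; apply: zy.
  by apply: KT => //; rewrite ltrDl.
by move=> /Fy[[T e] /= e0 TeG]; exists T, e.
Qed.

Lemma entire_solution_equicontinuous (e : R) : 0 < e ->
  exists2 delta : R, 0 < delta & forall z s t, S z -> `|s - t| < delta ->
    mdist (z s) (z t) < e.
Proof.
move=> e0; have [delta d0 H] := svds_small_time M_compact PhiP e0.
exists delta => // z s t Sz; wlog st : s t / s <= t => [wH|].
  have /orP[st|ts] := le_total s t; first exact: wH.
  by rewrite distrC metric_sym; exact: wH.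
rewrite distrC ger0_norm ?subr_ge0// => std.
by apply: (H (t - s)) => //; [rewrite subr_ge0|exact: Sz].
Qed.

(** Semicontinuity at a fixed duration t - s passes the relation between
    z(s) and z(t) to pointwise limits. *)
Lemma closed_entire_solutions : closed S.
Proof.
move=> y Sy s t st; have ts0 : 0 <= t - s by rewrite subr_ge0.
have near_y (e : R) : 0 < e -> exists2 z, S z &
    mdist (y s) (z s) < e /\ mdist (y t) (z t) < e.
  move=> e0; have [z [Sz yz]] := Sy _ (nbhs_uniformly_near (Num.max `|s| `|t|) y e0).
  by exists z => //; split; apply: yz; rewrite le_max lexx ?orbT.
apply: (svds_closed PhiP) => // B /nbhs_ballP[e /= e0 eB].
have e20 : 0 < e / 2 by rewrite divr_gt0.
have [delta d0 usc] := svds_point_dist PhiP (y s) ts0 e20.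
have [|z Sz [yzs yzt]] := near_y (Num.min delta (e / 2)); first by rewrite lt_min d0.
move: yzs yzt; rewrite !lt_min => /andP[yzs _] /andP[_ yzt].
have [w Phiw zw] := usc _ yzs _ (Sz _ _ st).
exists w; split => //; apply: eB; rewrite ballEmdist /=.
have := metric_triangle (y t) (z t) w; lra.
Qed.

Lemma compact_entire_solutions : compact S.
Proof.
have -> : S = closure S by apply/closure_id; exact: closed_entire_solutions.
rewrite -precompactE; apply: pointwise_precompact_equicontinuous.
- exact: metric_hausdorff.
- by move=> s; apply: (@precompact_subset _ _ setT) => //; 
  exact: compact_precompact (@metric_hausdorff _ _) M_compact.
- move=> s E /mdist_lt_sub_entourage[e e0 eE].
  have [delta d0 H] := entire_solution_equicontinuous e0.
  near=> t => z Sz; apply: eE; apply: H => //.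
Unshelve. all: by end_near. Qed.

Lemma compact_solution_space : compact [set: S].
Proof.
move=> F FF _.
have [|y [Sy ycl]] := @compact_entire_solutions (set_val @ F) _.
  by apply: (@filterS _ F _ setT) => [z _|]; [exact: set_valP|exact: filterT].
exists (SigSub (mem_set Sy)); split => // A B FA [_ [[U oU <-] /= Uy UB]].
have [||_ [[z Az <-] Uz]] := ycl (set_val @` A) U.
- by apply: (@filterS _ F _ A) => // z Az; exists z.
- exact: open_nbhs_nbhs.
- by exists z; split => //; exact: UB.
Qed.

Lemma nbhs_solutionP (z : S) (G : set S) : nbhs z G <->
  exists T e : R, 0 < e /\ forall z' : S,
    uniformly_near T e (set_val z) (set_val z') -> G z'.
Proof.
split=> [[_ [[U oU <-] /= Uz UG]]|[T [e [e0 eG]]]].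
  have [|T [e [e0 eU]]] := @uniformly_near_nbhs (set_val z) U.
    exact: open_nbhs_nbhs.
  by exists T, e; split => // z' /eU /UG.
have := @initial_continuous S _ set_val z _ (nbhs_uniformly_near T (set_val z) e0).
by apply: (@filterS _ (nbhs z)) => z' /eG.
Qed.

Lemma hausdorff_solution_space : hausdorff_space S.
Proof.
move=> y z yz; apply/val_inj/funext => s.
apply: contrapT => /eqP; rewrite -mdist_gt0 => d0.
have d20 : 0 < mdist (set_val y s) (set_val z s) / 2 by rewrite divr_gt0.
have nb (w : S) : nbhs w [set w' : S | uniformly_near `|s|
    (mdist (set_val y s) (set_val z s) / 2) (set_val w) (set_val w')].
  by apply/nbhs_solutionP; exists `|s|, (mdist (set_val y s) (set_val z s) / 2).
have [w [/(_ s (lexx _)) yw /(_ s (lexx _)) zw]] := yz _ _ (nb y) (nb z).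
have := metric_triangle (set_val y s) (set_val w s) (set_val z s).
rewrite (metric_sym (set_val w s)); lra.
Qed.

Lemma solution_translation_continuous (u : R) :
  continuous (@solution_translation R M Phi u).
Proof.
move=> z G /nbhs_solutionP[T [e [e0 eG]]].
apply/nbhs_solutionP; exists (`|u| + T), e; split => // z' zz'.
apply: eG => s sT; apply: zz'; apply: (le_trans (ler_normD _ _)).
by rewrite lerD2l.
Qed.

Lemma evaluation_continuous (s : R) : continuous (fun z : S => set_val z s).
Proof.
move=> z G /nbhs_ballP[e /= e0 eG]; apply/nbhs_solutionP.
exists `|s|, e; split => // z' /(_ s (lexx _)) zz'; apply: eG.
by rewrite ballEmdist.
Qed.

(** The compactness of the space of solutions gives a neighborhood of C of
    uniform size inside G. *)
Lemma closed_sub_open_uniform (C G : set S) : closed C -> open G -> C `<=` G ->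
  exists T e : R, 0 < e /\ forall z z' : S, C z ->
    uniformly_near T e (set_val z) (set_val z') -> G z'.
Proof.
move=> cC oG CG; apply: contrapT => H.
have {H}/choice[zz zzP] : forall n : nat, exists zz : S * S, [/\ C zz.1, ~ G zz.2 &
    uniformly_near n%:R n.+1%:R^-1 (set_val zz.1) (set_val zz.2)].
  move=> n; apply: contrapT => Hn; apply: H; exists n%:R, n.+1%:R^-1; split => //.
  move=> z z' Cz zz'; apply: contrapT => nG; apply: Hn; by exists (z, z').
have cptC : compact C := subclosed_compact cC compact_solution_space (@subsetT _ C).
have [|z [Cz zcl]] := cptC ((fun n => (zz n).1) @ \oo) _.
  by apply: (@filterS _ \oo _ setT) => [n _|]; [case: (zzP n)|exact: filterT].
have /nbhs_solutionP[T [e [e0 eG]]] : nbhs z G.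
  by apply: open_nbhs_nbhs; split => //; exact: CG.
have e20 : 0 < e / 2 by rewrite divr_gt0.
have [] := zcl [set (zz n).1 | n in [set n | T <= n%:R /\ n.+1%:R^-1 < e / 2]]
  [set z' : S | uniformly_near T (e / 2) (set_val z) (set_val z')].
- apply: filterS (filterI (nbhs_infty_ger T) (near_infty_natSinv_lt (PosNum e20))).
  by move=> n [Tn ne]; exists n.
- by apply/nbhs_solutionP; exists T, (e / 2).
- move=> _ [[n [Tn ne] <-] zn]; have [_ + nzz] := zzP n; apply; apply: eG.
  move=> s sT; have h1 := zn s sT; have h2 := lt_trans (nzz s (le_trans sT Tn)) ne.
  rewrite (splitr e); apply: (le_lt_trans (metric_triangle _ (set_val (zz n).1 s) _)).
  exact: ltrD.
Qed.

End entire_solutions.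

(** * Borel measures on metric spaces *)

(** The measurability of the map is an explicit argument, so that maps which
    are only proved measurable along the way have a push-forward measure. *)
Definition image_measure {d1 d2 : measure_display} {T1 : measurableType d1}
    {T2 : measurableType d2} {R : realFieldType}
    (m : {measure set T1 -> \bar R}) (f : T1 -> T2)
    (mf : measurable_fun setT f) : {measure set T2 -> \bar R} :=
  measure_function_pushforward__canonical__measure_function_Measure m mf.

Section borel_measures.
Context {R : realType}.

Lemma borel_open (T : ptopologicalType) (U : set T) :
  open U -> measurable (U : set (borel T)).
Proof. exact: sub_sigma_algebra. Qed.

Lemma borel_closed (T : ptopologicalType) (C : set T) :
  closed C -> measurable (C : set (borel T)).
Proof.
move=> cC; rewrite -(setCK C); apply: measurableC.
exact: (borel_open (closed_openC cC)).
Qed.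

Lemma borel_continuous (S T : ptopologicalType) (f : S -> T) : continuous f ->
  measurable_fun setT (f : borel S -> borel T).
Proof.
move=> cf.
apply: (@measurability _ _ (borel S) (borel T) setT f (@open T)) => // _ [U oU <-].
by rewrite setTI; apply: borel_open; apply: open_comp => // x _; exact: cf.
Qed.

Lemma borel_measure_closed_open (T : ptopologicalType)
    (m : {measure set (borel T) -> \bar R}) (U : set T) : m setT = 1%E ->
  open U -> m U = (1 - m (~` U))%E.
Proof.
move=> m1 oU; have mU := borel_open oU.
have mfin : m (~` U) \is a fin_num.
  rewrite ge0_fin_numE ?measure_ge0//; apply: (@le_lt_trans _ _ (m setT)).
    by apply: le_measure => //; apply/mem_set; [exact: measurableC|exact: measurableT].
  by rewrite m1 ltry.
rewrite -m1 -(setUv U) measureU ?setICr ?addeK//.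
exact: measurableC.
Qed.

Lemma borel_measure_eq (T : ptopologicalType)
    (m1 m2 : {measure set (borel T) -> \bar R}) :
  m1 setT = 1%E -> m2 setT = 1%E ->
  (forall C : set T, closed C -> m1 C = m2 C) ->
  forall A, measurable A -> m1 A = m2 A.
Proof.
move=> m1T m2T m12 A mA.
apply: (@measure_unique _ R (borel T) (@open T) (fun=> setT)) => //.
- by move=> U V; exact: openI.
- by move=> _; exact: openT.
- by apply/seteqP; split => // x _; exists 0.
- move=> U oU; rewrite (borel_measure_closed_open m1T oU).
  by rewrite (borel_measure_closed_open m2T oU) m12//; exact: open_closedC.
- by move=> _; rewrite m1T ltry.
Qed.

Context {M : pmetricType R}.

Definition enlargement (C : set M) (r : R) : set M :=
  [set y | exists2 x, C x & mdist x y < r].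

Lemma open_enlargement C r : open (enlargement C r).
Proof.
have -> : enlargement C r = \bigcup_(x in C) [set y | mdist x y < r].
  by apply/seteqP; split => y [x Cx xy]; exists x.
by apply: bigcup_open => x _; exact: open_mdist_lt.
Qed.

Lemma enlargementD C r e y y' : enlargement C r y -> mdist y y' < e ->
  enlargement C (r + e) y'.
Proof.
move=> [x Cx xy] yy'; exists x => //.
by apply: (le_lt_trans (metric_triangle x y y')); exact: ltrD.
Qed.

Lemma closure_enlargement C r e : 0 < e ->
  closure (enlargement C r) `<=` enlargement C (r + e).
Proof.
move=> e0 y /(_ _ (nbhsx_ballx y e e0))[z [Cz]]; rewrite ballEmdist /= => yz.
by apply: enlargementD Cz _; rewrite metric_sym.
Qed.

(** The enlargements of radius 1/(n+1) decrease to the closed set. *)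
Lemma enlargement_measure_approx (m : {measure set (borel M) -> \bar R})
    (C : set M) (e : R) : m setT = 1%E -> closed C -> 0 < e ->
  exists2 r : R, 0 < r & (m (enlargement C r) < m C + e%:E)%E.
Proof.
move=> m1 cC e0; pose G n := enlargement C n.+1%:R^-1.
have mG n : measurable (G n : set (borel M)).
  by apply: borel_open; exact: open_enlargement.
have capG : \bigcap_n G n = C.
  apply/seteqP; split => [y Gy|y Cy n _]; last first.
    by exists y => //; rewrite mdistxx.
  apply: cC => B /nbhs_ballP[r /= r0 rB].
  have [n _ /(_ n (leqnn n)) /= nr] := near_infty_natSinv_lt (PosNum r0).
  have [x Cx xy] := Gy n I; exists x; split => //; apply: rB.
  by rewrite ballEmdist /= metric_sym (lt_trans xy).
have mle1 A : measurable (A : set (borel M)) -> (m A <= 1)%E.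
  by move=> mA; rewrite -m1; apply: le_measure => //; apply/mem_set.
have mCfin : m C \is a fin_num.
  by rewrite ge0_fin_numE// (le_lt_trans (mle1 _ (borel_closed cC)))// ltry.
have : m (G n) @[n --> \oo] --> m (\bigcap_n G n).
  apply: nonincreasing_cvg_mu => //.
  - by rewrite (le_lt_trans (mle1 _ (mG 0)))// ltry.
  - exact: bigcapT_measurable.
  - move=> n n' nn'; apply/subsetPset => y [x Cx xy]; exists x => //.
    by apply: (lt_le_trans xy); rewrite lef_pV2 ?posrE ?ltr0n// ler_nat ltnS.
rewrite capG => mGC.
have : \forall n \near \oo, (m (G n) < m C + e%:E)%E.
  have : (m C < m C + e%:E)%E by rewrite lteDl// lte_fin.
  move=> mCe; apply: (mGC [set y | (y < m C + e%:E)%E]); apply: open_nbhs_nbhs.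
  by split => //; exact: open_ereal_lt_ereal.
by move=> [n _ /(_ n (leqnn n)) nP]; exists n.+1%:R^-1.
Qed.

(** Passing to complements reverses the inequality on open sets, and closed
    sets are approximated from outside by their open enlargements. *)
Lemma borel_measure_eq_le (m1 m2 : {measure set (borel M) -> \bar R}) :
  m1 setT = 1%E -> m2 setT = 1%E ->
  (forall C : set M, closed C -> (m1 C <= m2 C)%E) ->
  forall A, measurable A -> m1 A = m2 A.
Proof.
move=> m1T m2T m12; apply: borel_measure_eq => // C cC.
apply/eqP; rewrite eq_le m12//=; apply/lee_addgt0Pr => e e0.
have [r r0 rC] := enlargement_measure_approx m1T cC e0.
have oCr := open_enlargement C r.
apply: (@le_trans _ _ (m2 (enlargement C r))).
  apply: le_measure.
  - by apply/mem_set; exact: borel_closed.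
  - by apply/mem_set; exact: borel_open.
  - by move=> x Cx; exists x => //; rewrite mdistxx.
apply: (@le_trans _ _ (m1 (enlargement C r))); last exact: ltW.
rewrite (borel_measure_closed_open m1T oCr) (borel_measure_closed_open m2T oCr).
by apply: leeB => //; apply: m12; exact: open_closedC.
Qed.

End borel_measures.

(** * From finitely additive contents to Borel measures *)

Record is_content {R : realType} {T : Type} (m : set T -> R) : Prop := IsContent {
  content_ge0 : forall A, 0 <= m A;
  content_setT : m setT = 1;
  content_setU : forall A B, A `&` B = set0 -> m (A `|` B) = m A + m B }.

Section content.
Context {R : realType} {T : Type} (m : set T -> R) (mP : is_content m).

Lemma content_set0 : m set0 = 0.
Proof.
have := content_setU mP (set0I set0); rewrite setU0 => /eqP.
by rewrite -subr_eq subrr => /eqP.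
Qed.

Lemma content_le A B : A `<=` B -> m A <= m B.
Proof.
move=> AB; rewrite -(setDUK AB) (content_setU mP) ?setDIK//.
by rewrite lerDl (content_ge0 mP).
Qed.

Lemma content_setC A : m (~` A) = 1 - m A.
Proof.
by rewrite -(content_setT mP) -(setUv A) (content_setU mP) ?setICr// addrC addKr.
Qed.

Lemma content_subU A B : m (A `|` B) <= m A + m B.
Proof.
have -> : A `|` B = A `|` (B `\` A).
  by rewrite setDE setUIr setUv setIT.
by rewrite (content_setU mP) ?setDIK// lerD2l; apply: content_le; exact: subDsetl.
Qed.

End content.

Section regular_measure.
Context {R : realType} {T : ptopologicalType}.
Variables (m : set T -> R) (mP : is_content m).

(** Values of a content are trusted on closed sets only: this inner
    regularization is countably subadditive on open sets by compactness,
    whereas m itself need not be. *)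
Definition inner_content (U : set T) : \bar R :=
  ereal_sup [set (m C)%:E | C in [set C | closed C /\ C `<=` U]].

Definition outer_content (A : set T) : \bar R :=
  ereal_inf [set inner_content U | U in [set U | open U /\ A `<=` U]].

Lemma inner_content_ge0 U : (0 <= inner_content U)%E.
Proof.
apply: ereal_sup_ubound; exists set0; first by split => //; exact: closed0.
by rewrite content_set0.
Qed.

Lemma inner_content_le U V : U `<=` V -> (inner_content U <= inner_content V)%E.
Proof.
move=> UV; apply: ereal_sup_le => _ [C [cC CU] <-].
by exists C => //; split => //; exact: subset_trans UV.
Qed.

Lemma inner_content_le_content U : (inner_content U <= (m U)%:E)%E.
Proof.
apply: ge_ereal_sup => _ [C [cC CU] <-]; rewrite lee_fin; exact: content_le.
Qed.

Lemma outer_content_ge0 A : (0 <= outer_content A)%E.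
Proof. by apply: le_ereal_inf_tmp => _ [U _ <-]; exact: inner_content_ge0. Qed.

Lemma outer_content_le A B : A `<=` B -> (outer_content A <= outer_content B)%E.
Proof.
move=> AB; apply: ereal_inf_le_tmp => _ [U [oU BU] <-].
by exists U => //; split => //; exact: subset_trans BU.
Qed.

Lemma outer_content_open U : open U -> outer_content U = inner_content U.
Proof.
move=> oU; apply/eqP; rewrite eq_le; apply/andP; split.
  by apply: ereal_inf_lbound; exists U => //; split.
by apply: le_ereal_inf_tmp => _ [V [oV UV] <-]; exact: inner_content_le.
Qed.

Lemma outer_content_fin_num A : outer_content A \is a fin_num.
Proof.
rewrite ge0_fin_numE ?outer_content_ge0//.
apply: (le_lt_trans (outer_content_le (@subsetT _ A))).
rewrite outer_content_open; last exact: openT.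
by apply: (le_lt_trans (inner_content_le_content _)); rewrite ltry.
Qed.

Lemma outer_content_open_approx A (e : R) : 0 < e ->
  exists U, [/\ open U, A `<=` U & (inner_content U < outer_content A + e%:E)%E].
Proof.
move=> e0; have := lb_ereal_inf_adherent e0 (outer_content_fin_num A).
by case=> _ [U [oU AU] <-] Ue; exists U.
Qed.

Hypotheses (T_hausdorff : hausdorff_space T) (T_compact : compact [set: T]).

(** Normality separates C minus U from C minus V; remove the separating open
    sets. *)
Lemma closed_setU_split (C U V : set T) : closed C -> open U -> open V ->
  C `<=` U `|` V ->
  exists C1 C2, [/\ closed C1 /\ closed C2, C1 `<=` U, C2 `<=` V & C `<=` C1 `|` C2].
Proof.
move=> cC oU oV CUV.
have/(@normal_openP R)/(_ (C `\` U) (C `\` V)) := compact_normal T_hausdorff T_compact.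
case.
- by rewrite setDE; apply: closedI => //; exact: open_closedC.
- by rewrite setDE; apply: closedI => //; exact: open_closedC.
- rewrite -subset0 => x [[Cx nU] [_ nV]]; by case: (CUV x Cx).
move=> A [B [oA oB CA CB AB]]; exists (C `\` A), (C `\` B); split.
- by split; rewrite setDE; apply: closedI => //; exact: open_closedC.
- by move=> x [Cx nA]; apply: contrapT => nU; apply: nA; exact: CA.
- by move=> x [Cx nA]; apply: contrapT => nU; apply: nA; exact: CB.
- move=> x Cx; have [Ax|nAx] := pselect (A x); last by left.
  right; split => // Bx; suff : (A `&` B) x by rewrite AB.
  by split.
Qed.

(** Induction on n: split off the part of C covered by the last open set. *)
Lemma content_le_sum_inner (U : (set T)^nat) (C : set T) (n : nat) :
  (forall i, open (U i)) -> closed C -> C `<=` \bigcup_(i in `I_n) U i ->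
  ((m C)%:E <= \sum_(i < n) inner_content (U i))%E.
Proof.
move=> oU; elim: n C => [|n IH] C cC CU.
  have -> : C = set0 by rewrite -subset0 => x /CU [].
  by rewrite big_ord0 content_set0.
have oV : open (\bigcup_(i in `I_n) U i) by apply: bigcup_open => i _.
have CV : C `<=` \bigcup_(i in `I_n) U i `|` U n.
  move=> x /CU [i /= + Ux]; rewrite ltnS leq_eqVlt => /orP[/eqP in_|in_].
    by right; rewrite -in_.
  by left; exists i.
have [C1 [C2 [[cC1 cC2] C1U C2U CC]]] := closed_setU_split cC oV (oU n) CV.
rewrite big_ord_recr/=; apply: (@le_trans _ _ ((m C1)%:E + (m C2)%:E)%E).
  rewrite -EFinD lee_fin; apply: (le_trans (content_le mP CC)).
  exact: content_subU.
apply: leeD; first exact: IH.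
by apply: ereal_sup_ubound; exists C2.
Qed.

Lemma inner_content_bigcup (U : (set T)^nat) : (forall i, open (U i)) ->
  (inner_content (\bigcup_i U i) <= \sum_(i <oo) inner_content (U i))%E.
Proof.
move=> oU; apply: ge_ereal_sup => _ [C [cC CU] <-].
have cptC : cover_compact C.
  by rewrite -compact_cover; exact: (subclosed_compact cC T_compact).
have [D _ CD] : finite_subset_cover setT U C by exact: cptC.
pose n := (\max_(j <- enum_fset D) j).+1.
have : ((m C)%:E <= \sum_(i < n) inner_content (U i))%E.
  apply: content_le_sum_inner => // x /CD [i /= iD Ux]; exists i => //=.
  by rewrite ltnS; exact: leq_bigmax_seq.
move/le_trans; apply.
rewrite -(big_mkord xpredT (fun i => inner_content (U i))).
by apply: nneseries_lim_ge => i _ _; exact: inner_content_ge0.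
Qed.

Lemma outer_content_sigma_subadditive : sigma_subadditive outer_content.
Proof.
move=> A; apply/lee_addgt0Pr => e e0.
have /choice[U UP] : forall n, exists U, [/\ open U, A n `<=` U &
    (inner_content U < outer_content (A n) + (e / (2 ^ n.+1)%:R)%:E)%E].
  move=> n; apply: outer_content_open_approx.
  by rewrite divr_gt0// ltr0n expn_gt0.
apply: (@le_trans _ _ (\sum_(n <oo) inner_content (U n))%E).
  apply: (le_trans _ (inner_content_bigcup _)); last by move=> i; case: (UP i).
  apply: ereal_inf_lbound; exists (\bigcup_i U i) => //; split.
    by apply: bigcup_open => i _; case: (UP i).
  by apply: subset_bigcup => i _; case: (UP i).
apply: le_trans (epsilon_trick xpredT _ (ltW e0)) => //.
  apply: lee_nneseries => [i _ _|i _]; first exact: inner_content_ge0.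
  by case: (UP i) => _ _ /ltW.
by move=> n; exact: outer_content_ge0.
Qed.

Lemma outer_content0 : outer_content set0 = 0%E.
Proof.
rewrite outer_content_open; last exact: open0.
apply/eqP; rewrite eq_le inner_content_ge0 andbT.
by apply: (le_trans (inner_content_le_content _)); rewrite content_set0.
Qed.

Lemma outer_content_setT : outer_content setT = 1%E.
Proof.
rewrite outer_content_open; last exact: openT.
apply/eqP; rewrite eq_le; apply/andP; split.
  by apply: (le_trans (inner_content_le_content _)); rewrite content_setT.
apply: ereal_sup_ubound; exists setT; last by rewrite content_setT.
by split => //; exact: closedT.
Qed.

HB.instance Definition _ := @isOuterMeasure.Build R T outer_content
  outer_content0 outer_content_ge0 outer_content_le
  outer_content_sigma_subadditive.

(** Inside an open W, approximate the part in U from inside by a closed C,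
    then W minus C from inside by a closed set; the two closed sets are
    disjoint, so that their contents add up to at most the inner content of
    W. *)
Lemma open_caratheodory (U : set T) : open U -> outer_content.-caratheodory U.
Proof.
move=> oU; apply: le_caratheodory_measurable => X.
apply: le_ereal_inf_tmp => _ [W [oW XW] <-].
apply/lee_addgt0Pr => e e0.
have WUfin : inner_content (W `&` U) \is a fin_num.
  rewrite -outer_content_open; last exact: openI.
  exact: outer_content_fin_num.
have e20 : 0 < e / 2 by rewrite divr_gt0.
have [_ [C [cC CWU] <-] Ce] := ub_ereal_sup_adherent e20 WUfin.
have oWC : open (W `\` C) by rewrite setDE; apply: openI => //; exact: closed_openC.
have WCfin : inner_content (W `\` C) \is a fin_num.
  by rewrite -outer_content_open//; exact: outer_content_fin_num.
have [_ [C' [cC' CWC'] <-] Ce'] := ub_ereal_sup_adherent e20 WCfin.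
have CC' : C `&` C' = set0.
  by rewrite -subset0 => x [Cx /CWC' [_]].
have : ((m (C `|` C'))%:E <= inner_content W)%E.
  apply: ereal_sup_ubound; exists (C `|` C') => //; split; first exact: closedU.
  by move=> x [/CWU []|/CWC' []].
rewrite (content_setU mP CC') => CCW.
have le1 : (outer_content (X `&` U) <= inner_content (W `&` U))%E.
  rewrite -outer_content_open; last exact: openI.
  by apply: outer_content_le; exact: setSI.
have le2 : (outer_content (X `&` ~` U) <= inner_content (W `\` C))%E.
  rewrite -outer_content_open//; apply: outer_content_le => x [Xx nU].
  by split; [exact: XW|move=> /CWU []].
apply: (le_trans (leeD le1 le2)).
apply: le_trans (leeD CCW (lexx _)).
move: Ce Ce'; rewrite -/(inner_content _) -/(inner_content _).
rewrite -(fineK WUfin) -(fineK WCfin) -!EFinB !lte_fin => Ce Ce'.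
by rewrite -!EFinD lee_fin; lra.
Qed.

Lemma borel_caratheodory (A : set (borel T)) :
  measurable A -> outer_content.-caratheodory A.
Proof.
apply: smallest_sub.
  split; first exact: (caratheodory_measurable_set0 outer_content).
    move=> B BP; rewrite setTD.
    exact: (caratheodory_measurable_setC BP).
  exact: (caratheodory_measurable_bigcup (mu := outer_content)).
exact: open_caratheodory.
Qed.

Definition content_measure : set (borel T) -> \bar R := outer_content.

Lemma content_measure_sigma_additive : semi_sigma_additive content_measure.
Proof.
move=> A mA tA mUA.
by apply: (@caratheodory_measure_sigma_additive _ _ outer_content) => // [i|];
  exact: borel_caratheodory.
Qed.

HB.instance Definition _ := isMeasure.Build _ (borel T) R content_measure
  outer_content0 outer_content_ge0 content_measure_sigma_additive.

HB.instance Definition _ := Measure_isProbability.Build _ (borel T) R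
  content_measure outer_content_setT.

(** The Caratheodory measure of the inner content. It can differ from m by
    mass sitting near a set without being on it, whence the inequalities in
    opposite directions on open and on closed sets. *)
Lemma regular_probability_of_content : exists nu : probability (borel T) R,
  [/\ forall U : set T, open U -> (nu U <= (m U)%:E)%E,
      forall C : set T, closed C -> ((m C)%:E <= nu C)%E &
      forall (A : set T) (e : R), 0 < e -> exists U : set T,
        [/\ open U, A `<=` U & (nu U < nu A + e%:E)%E]].
Proof.
exists content_measure.
have nuU (U : set T) : open U -> (content_measure U <= (m U)%:E)%E.
  move=> oU; rewrite /content_measure outer_content_open//.
  exact: inner_content_le_content.
split => //.
  move=> C cC; have mC : measurable (C : set (borel T)).
    rewrite -(setCK C); apply: measurableC; apply: sub_sigma_algebra.
    exact: closed_openC.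
  have nuC : content_measure C = (1 - content_measure (~` C))%E.
    by rewrite -probability_setC ?setCK//; exact: measurableC.
  rewrite -[X in (_ <= X)%E]/(content_measure C) nuC.
  apply: (@le_trans _ _ (1 - (m (~` C))%:E)%E).
    by rewrite content_setC// -EFinB lee_fin opprB addrC subrK.
  by apply: leeB => //; apply: nuU; exact: closed_openC.
move=> A e e0; have [U [oU AU Ue]] := outer_content_open_approx A e0.
exists U; split => //; rewrite -[X in (X < _)%E]/(outer_content U).
by rewrite outer_content_open.
Qed.

End regular_measure.

(** * Events with small conditional probability *)

Lemma bin_le_expn2 n m : ('C(n, m) <= 2 ^ n)%N.
Proof.
elim: n m => [|n IH] [|m]; rewrite ?bin0 ?expn_gt0//.
by rewrite binS expnS mul2n -addnn leq_add.
Qed.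

Section rare_events.
Context {R : realType} {d : measure_display} {Omega : measurableType d}.
Variable P : probability Omega R.

Definition occurrences (E : nat -> set Omega) (n : nat) (w : Omega) : nat :=
  \sum_(i < n) (w \in E i).

Lemma occurrences_le E n w : (occurrences E n w <= n)%N.
Proof.
by rewrite -[leqRHS]card_ord -sum1_card; apply: leq_sum => i _; case: (_ \in _).
Qed.

(** The event version of the recursion in Pascal's triangle. *)
Lemma occurrencesS_ge E n j : [set w | (j.+1 <= occurrences E n.+1 w)%N] =
  [set w | (j.+1 <= occurrences E n w)%N] `|`
  ([set w | (j <= occurrences E n w)%N] `&` E n).
Proof.
apply/seteqP; split => w /=; rewrite /occurrences big_ord_recr/=.
  have [/set_mem Ew|_] := boolP (w \in E n); last by rewrite addn0; left.
  by rewrite addn1 ltnS => ?; right.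
case=> [h|[h /mem_set ->]]; last by rewrite addn1.
by apply: (leq_trans h); rewrite leq_addr.
Qed.

Variables (F : nat -> set (set Omega)).
Hypotheses (F_sigma : forall i, sigma_algebra setT (F i))
  (F_measurable : forall i, F i `<=` measurable)
  (F_nondecreasing : forall i, F i `<=` F i.+1).

Section bounded_conditional_probability.
Variables (E : nat -> set Omega) (eps : R).
Hypotheses (eps_ge0 : 0 <= eps) (E_adapted : forall i, F i.+1 (E i))
  (E_rare : forall i H, F i H -> (P (E i `&` H) <= eps%:E * P H)%E).

Lemma occurrences_adapted n j : F n [set w | (j <= occurrences E n w)%N].
Proof.
have FT i : F i setT by rewrite -(setD0 setT); case: (F_sigma i) => ? + _; apply.
have FU i A B : F i A -> F i B -> F i (A `|` B).
  move=> FA FB; rewrite -bigcup2E; case: (F_sigma i) => F0 _; apply.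
  by move=> [|[|n']].
have FC i A : F i A -> F i (~` A).
  by move=> FA; rewrite -setTD; case: (F_sigma i) => ? + _; apply.
have FI i A B : F i A -> F i B -> F i (A `&` B).
  by move=> FA FB; rewrite -(setCK A) -(setCK B) -setCU; apply/FC/FU; exact: FC.
elim: n j => [|n IH] [|j]; try by rewrite [X in F _ X](_ : _ = setT)//;
    apply/seteqP; split.
  rewrite [X in F _ X](_ : _ = set0); first by case: (F_sigma 0).
  by rewrite -subset0 => w /=; rewrite /occurrences big_ord0.
rewrite occurrencesS_ge; apply: FU; first exact/F_nondecreasing/IH.
by apply: FI => //; exact/F_nondecreasing/IH.
Qed.

(** Each new event costs a factor eps, whatever happened before, and there
    are C(n, j) ways to choose which j events occur. *)
Lemma probability_occurrences_ge n j :
  (P [set w | (j <= occurrences E n w)%N] <= ('C(n, j)%:R * eps ^+ j)%:E)%E.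
Proof.
elim: n j => [|n IH] [|j].
- by rewrite bin0 mul1r expr0 probability_le1//; exact/F_measurable/occurrences_adapted.
- rewrite [X in P X](_ : _ = set0) ?measure0 ?bin0n ?mul0r//.
  by rewrite -subset0 => w /=; rewrite /occurrences big_ord0.
- by rewrite bin0 mul1r expr0 probability_le1//; exact/F_measurable/occurrences_adapted.
have mO k : measurable [set w | (k <= occurrences E n w)%N].
  exact/F_measurable/occurrences_adapted.
have mE : measurable (E n) by exact: F_measurable (E_adapted n).
rewrite occurrencesS_ge; apply: (le_trans (measureU2 _ _ _)) => //.
  exact: measurableI.
rewrite binS natrD mulrDl EFinD; apply: leeD; first exact: IH.
rewrite setIC; apply: (le_trans (E_rare (occurrences_adapted n j))).
apply: (@le_trans _ _ (eps%:E * ('C(n, j)%:R * eps ^+ j)%:E)%E).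
  by apply: lee_wpmul2l; rewrite ?lee_fin.
by rewrite -EFinM lee_fin exprS mulrCA.
Qed.

(** With eps at most 4^-l, more than n/l occurrences have probability at
    most 2^n 4^-n, which is summable. *)
Lemma occurrences_eventually_le l : eps <= 4^-1 ^+ l ->
  {ae P, forall w, \forall n \near \oo, (occurrences E n w * l <= n)%N}.
Proof.
case: l => [_|l]; first by apply: aeW => w; apply: nearW => n; rewrite muln0.
move=> epsl; pose B n := [set w | (n %/ l.+1 < occurrences E n w)%N].
have mB n : measurable (B n) by exact/F_measurable/occurrences_adapted.
have PB n : (P (B n) <= (2 / (2 ^ n.+1)%:R)%:E)%E.
  apply: (le_trans (probability_occurrences_ge _ _)); rewrite lee_fin.
  have -> : 2 / (2 ^ n.+1)%:R = (2 ^ n)%:R * 4^-1 ^+ n :> R.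
    rewrite expnS natrM invfM mulrA mulfV ?pnatr_eq0// mul1r natrX exprVn.
    rewrite (_ : 4 = 2 * 2 :> R); last by rewrite -natrM.
    by rewrite exprMn invfM mulrA mulfV ?mul1r// expf_neq0// pnatr_eq0.
  apply: ler_pM => //; rewrite ?exprn_ge0//; first by rewrite ler_nat bin_le_expn2.
  apply: (@le_trans _ _ ((4^-1 ^+ l.+1) ^+ (n %/ l.+1).+1)).
    by apply: lerXn2r => //; rewrite nnegrE// exprn_ge0.
  rewrite -exprM; apply: ler_wiXn2l => //; first by lra.
  by rewrite mulnC ltnW// ltn_ceil.
have : P (lim_sup_set B) = 0%E.
  apply: lim_sup_set_cvg0 => //.
  (* Twice the series of 2^-(n+1). *)
  apply: (@le_lt_trans _ _ (2%:E)); last by rewrite ltry.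
  apply: le_trans (epsilon_trick0 xpredT _) => //.
  by apply: lee_nneseries => // n _; exact: PB.
move=> PB0; exists (lim_sup_set B); split => //.
  by apply: bigcap_measurable => // k _; exact: bigcup_measurable.
move=> w /= nw k _; apply: contrapT => nBw; apply: nw.
exists k => // n /= kn; rewrite leqNgt; apply/negP => h.
by apply: nBw; exists n => //; rewrite /B/= ltn_divLR.
Qed.

End bounded_conditional_probability.

Section vanishing_conditional_probability.
Variables (A E : nat -> set Omega) (p : nat -> Omega -> R).
Hypotheses (E_adapted : forall i, F i.+1 (E i)) (E_sub : forall i, E i `<=` A i)
  (p_version : forall i, cond_prob_version P (F i) (A i) (p i))
  (p_vanishes : {ae P, forall w, p n w @[n --> \oo] --> (0 : R)}).

Lemma sigma_algebra_setI i B C : F i B -> F i C -> F i (B `&` C).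
Proof.
rewrite -(sigma_algebra_id (F_sigma i)) => FB FC.
exact: (@measurableI _ (g_sigma_algebraType (F i))).
Qed.

Lemma cond_prob_le_measurable i (eps : R) : F i [set w | p i w <= eps].
Proof.
have [+ _ _] := p_version i.
move=> /(_ measurableT _ (measurable_itv `]-oo, eps])).
by rewrite setTI /measurable/= sigma_algebra_id.
Qed.

(** Restricted to the event that the conditional probability is at most eps,
    which is known at time i, the event E i has conditional probability at
    most eps. *)
Lemma cond_prob_rare i (eps : R) H : 0 <= eps -> F i H ->
  (P (E i `&` [set w | (p i w <= eps)%R] `&` H) <= eps%:E * P H)%E.
Proof.
move=> eps0 FH; have [_ pint [B [mB [N [mN PN0 AN]] BH]]] := p_version i.
pose H' := [set w | p i w <= eps] `&` H.
have FH' : F i H' by apply: sigma_algebra_setI => //; exact: cond_prob_le_measurable.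
have mH' : measurable H' by exact: F_measurable FH'.
have mH : measurable H by exact: F_measurable FH.
have mE : measurable (E i) by exact: F_measurable (E_adapted i).
rewrite -setIA -/H'.
apply: (@le_trans _ _ (P (B `&` H' `|` N))).
  apply: le_measure.
  - by apply/mem_set; exact: measurableI.
  - by apply/mem_set; apply: measurableU => //; exact: measurableI.
  - move=> w [/E_sub Aw H'w]; have [Bw|nBw] := pselect (B w); first by left.
    by right; apply: AN; left.
apply: (le_trans (measureU2 _ _ _)) => //; first exact: measurableI.
rewrite [X in (_ + X)%E]PN0 adde0 -[X in (X <= _)%E](BH _ FH').
apply: (@le_trans _ _ (\int[P]_(w in H') (cst eps%:E) w)%E).
  apply: le_integral => //.
  - exact: integrableS pint.
  - by apply: (@integrableS _ _ _ P setT) => //; exact: finite_measure_integrable_cst.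
  - by move=> w /set_mem[/= pw _]; rewrite lee_fin.
rewrite integral_cst//; apply: lee_wpmul2l; first by rewrite lee_fin.
by apply: le_measure; [exact/mem_set|exact/mem_set|move=> w []].
Qed.

(** Beyond a random index the conditional probabilities are below 4^-(2l),
    so that up to finitely many terms the events are counted together with
    this restriction. The factor 2 absorbs these terms. *)
Lemma occurrences_negligible :
  {ae P, forall w, forall l, \forall n \near \oo, (occurrences E n w * l <= n)%N}.
Proof.
have : {ae P, forall w, forall l, \forall n \near \oo,
    (occurrences (fun i => E i `&` [set w | (p i w <= 4^-1 ^+ l)%R]) n w * l <= n)%N}.
  apply: ae_foralln => l; apply: occurrences_eventually_le (lexx _).
  - by rewrite exprn_ge0.
  - move=> i; apply: sigma_algebra_setI => //.
    exact/F_nondecreasing/cond_prob_le_measurable.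
  - by move=> i H; apply: cond_prob_rare; rewrite exprn_ge0.
apply: filterS2 p_vanishes => w pw rare l.
have l20 : 0 < 4^-1 ^+ (l * 2) :> R by rewrite exprn_gt0.
have [n0 _ n0P] : \forall n \near \oo, p n w < 4^-1 ^+ (l * 2).
  exact: (cvgr_lt _ pw).
have [n1 _ n1P] := rare (l * 2)%N.
exists (maxn n1 (n0 * (l * 2))) => // n /=; rewrite geq_max => /andP[n1n n0n].
pose E' i := E i `&` [set w | p i w <= 4^-1 ^+ (l * 2)].
have le_occ k : (occurrences E k w <= n0 + occurrences E' k w)%N.
  elim: k => [|k IH]; first by rewrite /occurrences big_ord0.
  rewrite /occurrences !big_ord_recr/=; have [kn0|n0k] := ltnP k n0.
    rewrite (leq_trans _ (leq_addr _ _))//; apply: leq_trans kn0.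
    by have := occurrences_le E k.+1 w; rewrite /occurrences big_ord_recr.
  rewrite addnA; apply: leq_add; first exact: IH.
  have [/set_mem Ew|//] := boolP (w \in E k).
  by rewrite mem_set//; split => //=; rewrite ltW// n0P.
have h : (occurrences E' n w * (l * 2) <= n)%N := n1P n n1n; have h' := le_occ n.
rewrite -(@leq_pmul2r 2)// -mulnA.
apply: (@leq_trans ((n0 + occurrences E' n w) * (l * 2))).
  by rewrite leq_mul2r h' orbT.
by rewrite mulnDl (muln2 n) -addnn; exact: leq_add.
Qed.

End vanishing_conditional_probability.
End rare_events.

(** * Shadowing of the process by entire solutions *)

(** Density zero, stated without division. *)
Definition null_density (A : set nat) : Prop :=
  forall l, \forall N \near \oo, ((\sum_(k < N) ((k : nat) \in A)) * l <= N)%N.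

Lemma null_density_sub (A B : set nat) : A `<=` B -> null_density B -> null_density A.
Proof.
move=> AB Bnull l; apply: filterS (Bnull l) => N; apply: leq_trans.
rewrite leq_mul2r; apply/orP; right; apply: leq_sum => k _.
by have [/set_mem/AB/mem_set ->|//] := boolP ((k : nat) \in A).
Qed.

Lemma sum_residues (b : nat -> nat) (L n : nat) :
  (\sum_(k < n * L) b k = \sum_(a < L) \sum_(i < n) b (a + i * L))%N.
Proof.
elim: n => [|n IH].
  by rewrite mul0n big_ord0; symmetry; apply: big1 => a _; rewrite big_ord0.
rewrite mulSnr big_split_ord/= IH -big_split/=.
apply: eq_bigr => a _.
by rewrite big_ord_recr/= [(n * L + a)%N]addnC.
Qed.

(** A set of indices is a union of finitely many residue classes, each of
    density zero. *)
Lemma null_density_residues (A : set nat) (L : nat) : (0 < L)%N ->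
  (forall a, (a < L)%N -> null_density [set i | A (a + i * L)%N]) ->
  null_density A.
Proof.
move=> L0 Anull l.
have : forall K, (K <= L)%N -> \forall n \near \oo, forall a, (a < K)%N ->
    ((\sum_(i < n) ((i : nat) \in [set i | A (a + i * L)%N])) * (l * 2) <= n)%N.
  elim=> [_|a IH aL]; first by apply: nearW => n a.
  apply: filterS2 (IH (ltnW aL)) (Anull a aL (l * 2)%N) => n h1 h2 a'.
  by rewrite ltnS leq_eqVlt => /orP[/eqP ->|a'a]; [exact: h2|exact: h1].
move=> /(_ L (leqnn L))[n0 _ n0P]; exists (n0.+1 * L)%N => // N /= n0N.
have n0NL : (n0 <= (N %/ L).+1)%N.
  by rewrite ltnW// ltnS leq_divRL// (leq_trans _ n0N)// leq_mul2r leqnSn orbT.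
have LN : (L <= N)%N by rewrite (leq_trans _ n0N)// leq_pmull.
rewrite -(@leq_pmul2r 2)// -mulnA.
apply: (@leq_trans ((\sum_(k < (N %/ L).+1 * L) ((k : nat) \in A)) * (l * 2))).
  rewrite leq_mul2r; apply/orP; right.
  rewrite -!(big_mkord xpredT (fun k => nat_of_bool ((k : nat) \in A))).
  rewrite [leqRHS](big_cat_nat (n := N))//= ?leq_addr//.
  by rewrite ltnW// ltn_ceil.
rewrite (sum_residues (fun k => nat_of_bool ((k : nat) \in A))) big_distrl/=.
apply: (@leq_trans (\sum_(a < L) (N %/ L).+1)).
  by apply: leq_sum => a _; apply: (n0P _ n0NL).
rewrite sum_nat_const card_ord mulnS muln2 -addnn leq_add//.
by rewrite mulnC leq_divM.
Qed.

(** Only finitely many times are tested, which keeps the corresponding event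
    in the sigma-algebra generated up to the end of the window. *)
Definition shadowed {R : realType} {M : pmetricType R} (Phi : R -> M -> set M)
    (T J : nat) (e : R) (y : R -> M) : Prop :=
  exists2 z, entire_solutions Phi z & forall j, (j <= T * J.+1)%N ->
    mdist (z (j%:R / J.+1%:R)) (y (j%:R / J.+1%:R)) < e.

Section wapt.
Context {R : realType} {M : pmetricType R} {d : measure_display}
  {Omega : measurableType d}.
Variables (Phi : R -> M -> set M) (P : probability Omega R)
  (F : R -> set (set Omega)) (X : R -> Omega -> M).
Hypotheses (M_compact : compact [set: M]) (PhiP : is_svds Phi)
  (FP : is_filtration F) (XP : is_wapt P F Phi X).
Notation S := (entire_solutions Phi).

Lemma solution_net (T e : R) : 0 < e -> exists D : seq S, forall z : S,
  exists2 z' : S, z' \in D & uniformly_near T e (set_val z') (set_val z).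
Proof.
move=> e0; have [[z0]|S0] := pselect (inhabited S); last first.
  by exists [::] => z; case: S0.
pose U (z : pointed_at z0) : set (pointed_at z0) :=
  interior [set z' | uniformly_near T e (set_val (z : S)) (set_val (z' : S))].
have S_compact : cover_compact [set: pointed_at z0].
  by rewrite -compact_cover; exact: compact_solution_space.
have [||D _ TD] := S_compact _ setT U.
- by move=> z _; exact: open_interior.
- by move=> z _; exists z => //; apply/nbhs_solutionP; exists T, e; split.
exists (enum_fset D) => z.
have [z' /= z'D /interior_subset Uz] := TD z I.
by exists z'.
Qed.

(** Sections of a product-measurable set are measurable. *)
Lemma wapt_adapted (s t : R) (C : set M) : 0 <= s -> s <= t -> 0 < t ->
  closed C -> F t [set w | C (X s w)].
Proof.
move=> s0 st t0 cC.
have mD : measurable (`[0, t] `*` setT :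
    set (measurableTypeR R * g_sigma_algebraType (F t))) by exact: measurableX.
have := measurable_xsection s (wapt_progressive XP t0 mD (borel_closed cC)).
rewrite /measurable/= sigma_algebra_id; last first.
  exact: (filtration_sigma_algebra FP (ltW t0)).
congr (F t _); apply/seteqP; split => w /=.
  by move=> /xsectionP[].
by move=> Cw; apply/xsectionP; split => //=; split => //; rewrite in_itv/= s0.
Qed.

(** Comparing with finitely many solutions replaces the quantification over
    all of them by a finite intersection of events. *)
Definition far_from (D : seq S) (T J : nat) (e : R) (y : R -> M) : Prop :=
  forall z, z \in D -> exists2 j : nat, (j <= T * J.+1)%N &
    e <= mdist (set_val z (j%:R / J.+1%:R)) (y (j%:R / J.+1%:R)).

Lemma far_from_adapted D (T J : nat) (e r : R) : (0 < T)%N -> 0 <= r ->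
  F (r + T%:R) [set w | far_from D T J e (fun s => X (r + s) w)].
Proof.
move=> T0 r0; have T0' : 0 < T%:R :> R by rewrite ltr0n.
have rT0 : 0 < r + T%:R by rewrite ltr_wpDl.
have F_sigma := filtration_sigma_algebra FP (ltW rT0).
have -> : [set w | far_from D T J e (fun s => X (r + s) w)] =
    \big[setI/setT]_(z <- D) \big[setU/set0]_(j < (T * J.+1).+1)
      [set w | e <= mdist (set_val z (j%:R / J.+1%:R)) (X (r + j%:R / J.+1%:R) w)].
  apply/seteqP; split => w /=.
    move=> far; rewrite -bigcap_seq => z /= zD; have [j jT je] := far z zD.
    rewrite -(bigcup_mkord (T * J.+1).+1 (fun j =>
      [set w | e <= mdist (set_val z (j%:R / J.+1%:R)) (X (r + j%:R / J.+1%:R) w)])).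
    by exists j.
  rewrite -bigcap_seq => far z zD; have := far z zD.
  rewrite -(bigcup_mkord (T * J.+1).+1 (fun j =>
      [set w | e <= mdist (set_val z (j%:R / J.+1%:R)) (X (r + j%:R / J.+1%:R) w)])).
  by move=> [j /= jT je]; exists j.
rewrite -(sigma_algebra_id F_sigma).
apply: (@bigsetI_measurable _ (g_sigma_algebraType (F (r + T%:R)))) => z _.
apply: (@bigsetU_measurable _ (g_sigma_algebraType (F (r + T%:R)))) => j _.
apply: sub_sigma_algebra; have jT : j%:R / J.+1%:R <= T%:R :> R.
  by rewrite ler_pdivrMr ?ltr0n// -natrM ler_nat -ltnS.
apply: (@wapt_adapted _ _ [set x | e <= mdist (set_val z (j%:R / J.+1%:R)) x]) => //.
- by rewrite addr_ge0// divr_ge0.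
- by rewrite lerD2l.
- apply: (closed_comp (D := [set x | e <= x])) => [x _|]; last exact: closed_ge.
  exact: mdist_continuous.
Qed.

(** Every solution is within e of one in the net, so that being 2e away from
    the net implies being e away from all solutions. *)
Lemma far_from_sub_dist (D : seq S) (T J : nat) (e : R) (y : R -> M) :
  (forall z : S, exists2 z', z' \in D & uniformly_near T%:R e (set_val z') (set_val z)) ->
  far_from D T J (e * 2) y -> (e%:E <= dist_to_solutions Phi T%:R y)%E.
Proof.
move=> net far; apply: le_ereal_inf_tmp => _ [z Sz <-].
have [z' z'D near_z] := net (SigSub (mem_set Sz)).
have [j jT ej] := far z' z'D.
have jT' : j%:R / J.+1%:R <= T%:R :> R.
  by rewrite ler_pdivrMr ?ltr0n// -natrM ler_nat.
have j0 : 0 <= j%:R / J.+1%:R :> R by rewrite divr_ge0.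
apply: (@le_trans _ _ (mdist (y (j%:R / J.+1%:R)) (z (j%:R / J.+1%:R)))%:E).
  have := near_z (j%:R / J.+1%:R); rewrite ger0_norm// => /(_ jT').
  have := metric_triangle (set_val z' (j%:R / J.+1%:R)) (z (j%:R / J.+1%:R))
    (y (j%:R / J.+1%:R)).
  rewrite lee_fin (metric_sym (y _)) /=; lra.
apply: ereal_sup_ubound; exists (j%:R / J.+1%:R) => //.
by rewrite /= in_itv/= j0.
Qed.

Lemma not_shadowed_far_from (D : seq S) (T J : nat) (e : R) (y : R -> M) :
  ~ shadowed Phi T J e y -> far_from D T J e y.
Proof.
move=> nsh z zD; apply: contrapT => nfar; apply: nsh; exists (set_val z).
  exact: set_valP.
by move=> j jT; rewrite ltNge; apply/negP => ej; apply: nfar; exists j.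
Qed.

(** The step T of the progression equals the window length, so that each
    event is known when the next conditional probability is taken. *)
Lemma wapt_shadowed_progression (T J : nat) (e r : R) : (0 < T)%N -> 0 < e ->
  0 <= r ->
  {ae P, forall w, null_density
    [set i | ~ shadowed Phi T J e (fun s => X (r + i%:R * T%:R + s) w)]}.
Proof.
move=> T0 e0 r0; have T0' : 0 < T%:R :> R by rewrite ltr0n.
have e20 : 0 < e / 2 by rewrite divr_gt0.
have [D net] := solution_net T%:R e20.
have [p p_version p_vanishes] := wapt_asymptotic XP e20 T0'.
pose t (i : nat) := r + i%:R * T%:R.
have t0 i : 0 <= t i by rewrite addr_ge0// mulr_ge0.
have tS i : t i.+1 = t i + T%:R by rewrite /t -natr1 mulrDl mul1r addrA.
have : {ae P, forall w, forall l, \forall n \near \oo, (occurrences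
    (fun i => [set w | far_from D T J e (fun s => X (t i + s) w)]) n w * l <= n)%N}.
  apply: (@occurrences_negligible _ _ _ P (fun i => F (t i)) _ _ _
    (fun i => [set w | ((e / 2)%:E <=
                  dist_to_solutions Phi T%:R (fun s => X (t i + s)%R w))%E]) _
    (fun i => p (t i))).
  - by move=> i; exact: filtration_sigma_algebra.
  - by move=> i; exact: filtration_measurable.
  - by move=> i; apply: filtration_nondecreasing => //; rewrite tS lerDl ltW.
  - by move=> i; rewrite tS; exact: far_from_adapted.
  - move=> i w /= far; apply: far_from_sub_dist net _.
    by rewrite divfK ?pnatr_eq0 //; exact: far.
  - by move=> i; exact: p_version.
  - apply: filterS p_vanishes => w pw.
    apply: (@cvg_comp _ _ _ t (fun s => p s w) _ _ _ _ pw).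
    apply/cvgryPge => A; near=> n.
    rewrite (@le_trans _ _ (n%:R * T%:R))// ?lerDr//.
    rewrite (@le_trans _ _ n%:R)//; last by rewrite ler_peMr// ler1n.
    by near: n; exact: nbhs_infty_ger.
apply: filterS => w occ l; apply: filterS (occ l) => n; apply: leq_trans.
rewrite leq_mul2r; apply/orP; right; apply: leq_sum => i _.
have [/set_mem/= nsh|//] := boolP ((i : nat) \in _).
by rewrite mem_set//=; exact: not_shadowed_far_from.
Unshelve. all: by end_near. Qed.

(** The grid of mesh 1/(m+1) is the union of T(m+1) progressions of step T. *)
Lemma wapt_shadowed (m T J : nat) (e : R) : (0 < T)%N -> 0 < e ->
  {ae P, forall w, null_density
    [set k | ~ shadowed Phi T J e (fun s => X (k%:R / m.+1%:R + s) w)]}.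
Proof.
move=> T0 e0; have L0 : (0 < T * m.+1)%N by rewrite muln_gt0 T0.
have : {ae P, forall w, forall a, null_density
    [set i | ~ shadowed Phi T J e (fun s => X (a%:R / m.+1%:R + i%:R * T%:R + s) w)]}.
  apply: ae_foralln => a; apply: wapt_shadowed_progression => //.
apply: filterS => w h; apply: (null_density_residues L0) => a _.
apply: null_density_sub (h a) => i /=; congr (~ shadowed _ _ _ _ _).
apply/funext => s; congr (X (_ + s) w).
by rewrite natrD mulrDl !natrM mulrA mulfK// pnatr_eq0.
Qed.

End wapt.

(** * Finitely additive densities of sets of times *)

Section ultralimit.
Context {R : realType} {T : Type} (U : set_system T) {UU : UltraFilter U}.

Definition ultralimit (h : T -> R) : R := lim (h @ U).

Lemma cvg_ultralimit (h : T -> R) (a b : R) : (forall t, a <= h t <= b) ->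
  h @ U --> ultralimit h.
Proof.
move=> hab; have cptab : compact `[a, b]%classic by exact: segment_compact.
have [|p [_ clp]] := cptab (h @ U) _.
  by apply: (@filterS _ U _ setT) => [t _ /=|]; [rewrite in_itv/=|exact: filterT].
suff hp : h @ U --> p by rewrite /ultralimit (cvg_lim _ hp).
move=> B pB; have [//|UnB] := in_ultra_setVsetC (h @^-1` B) UU.
by have [x [nB Bx]] := clp (~` B) B UnB pB.
Qed.

Lemma ultralimit_le (h h' : T -> R) (a b e : R) :
  (forall t, a <= h t <= b) -> (forall t, a <= h' t <= b) ->
  (\forall t \near U, h t <= h' t + e) -> ultralimit h <= ultralimit h' + e.
Proof.
move=> hab h'ab hh'.
have cvgD : (fun t => h' t + e - h t) @ U --> ultralimit h' + e - ultralimit h.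
  apply: cvgB; last exact: cvg_ultralimit hab.
  by apply: cvgD; [exact: cvg_ultralimit h'ab|exact: cvg_cst].
rewrite -subr_ge0; apply: (cvgr_to_ge cvgD).
by apply: filterS hh' => t; rewrite subr_ge0.
Qed.

Lemma ultralimitD (h h' : T -> R) (a b : R) :
  (forall t, a <= h t <= b) -> (forall t, a <= h' t <= b) ->
  ultralimit (fun t => h t + h' t) = ultralimit h + ultralimit h'.
Proof.
move=> hab h'ab; apply: cvg_lim => //.
by apply: cvgD; [exact: cvg_ultralimit hab|exact: cvg_ultralimit h'ab].
Qed.

Lemma ultralimit_eq (h : T -> R) (c : R) : (\forall t \near U, h t = c) ->
  ultralimit h = c.
Proof. by move=> hc; apply: cvg_lim => //; exact: cvg_near_cst. Qed.

Lemma ultralimit_le_cst (h : T -> R) (a b c : R) :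
  (forall t, a <= h t <= b) -> (\forall t \near U, h t <= c) ->
  ultralimit h <= c.
Proof. by move=> hab; exact: cvgr_to_le (cvg_ultralimit hab). Qed.

Lemma ultralimit_itv (h : T -> R) (a b : R) :
  (forall t, a <= h t <= b) -> a <= ultralimit h <= b.
Proof.
move=> hab; apply/andP; split; last first.
  by apply: (ultralimit_le_cst hab); apply: nearW => t; case/andP: (hab t).
apply: (cvgr_to_ge (cvg_ultralimit hab)).
by apply: nearW => t; case/andP: (hab t).
Qed.

End ultralimit.

Section time_density.
Context {R : realType} (U : set_system R) (W : set_system nat).
Context {UU : UltraFilter U} {WU : UltraFilter W}.
Hypotheses (U_infty : pinfty_nbhs R `<=` U) (W_infty : \oo `<=` W).

Definition grid_count (A : set R) (m N : nat) : nat :=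
  \sum_(k < N) ((k%:R / m.+1%:R) \in A).

Definition grid_frequency (A : set R) (m N : nat) : R :=
  (grid_count A m N)%:R / N%:R.

Definition grid_size (t : R) (m : nat) : nat := Num.truncn (t * m.+1%:R).

Definition grid_density (A : set R) (m : nat) : R :=
  ultralimit U (fun t => grid_frequency A m (grid_size t m)).

(** The grid is refined only after the time horizon is sent to infinity, so
    that for each mesh exceptional sets of density zero disappear.
    Ultralimits, and sums instead of integrals, make it additive on all sets
    of times. *)
Definition time_density (A : set R) : R := ultralimit W (grid_density A).

Lemma grid_count_le A m N : (grid_count A m N <= N)%N.
Proof.
by rewrite -[leqRHS]card_ord -sum1_card; apply: leq_sum => k _; case: (_ \in _).
Qed.

Lemma grid_frequency_itv A m N : 0 <= grid_frequency A m N <= 1.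
Proof.
rewrite divr_ge0//=; case: N => [|N]; first by rewrite /grid_frequency invr0 mulr0.
by rewrite ler_pdivrMr ?ltr0n// mul1r ler_nat grid_count_le.
Qed.

Lemma grid_density_itv A m : 0 <= grid_density A m <= 1.
Proof. by apply: ultralimit_itv => t; exact: grid_frequency_itv. Qed.

Lemma time_density_itv A : 0 <= time_density A <= 1.
Proof. exact: ultralimit_itv (grid_density_itv A). Qed.

Lemma near_grid_size (m n : nat) : \forall t \near U, (n <= grid_size t m)%N.
Proof.
apply: U_infty; near=> t.
have t0 : 0 <= t by near: t; exact: nbhs_pinfty_ge.
rewrite /grid_size truncn_ge_nat; last by rewrite mulr_ge0.
apply: (@le_trans _ _ t); first by near: t; apply: nbhs_pinfty_ge; exact: num_real.
by rewrite ler_peMr// ler1n.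
Unshelve. all: by end_near. Qed.

Lemma time_density_le A B :
  (forall e, 0 < e -> \forall m \near \oo, \forall N \near \oo,
    grid_frequency A m N <= grid_frequency B m N + e) ->
  time_density A <= time_density B.
Proof.
move=> AB; apply/ler_addgt0Pr => e e0.
apply: (ultralimit_le (grid_density_itv A) (grid_density_itv B)).
apply: W_infty; apply: filterS (AB e e0) => m [n _ nP].
apply: (ultralimit_le (fun t => grid_frequency_itv A m (grid_size t m)) 
    (fun t => grid_frequency_itv B m (grid_size t m))).
by apply: filterS (near_grid_size m n) => t; exact: nP.
Qed.

Lemma time_density_le_cst A (c : R) :
  (forall e, 0 < e -> \forall m \near \oo, \forall t \near U,
    grid_frequency A m (grid_size t m) <= c + e) ->
  time_density A <= c.
Proof.
move=> Ac; apply/ler_addgt0Pr => e e0.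
apply: (ultralimit_le_cst (grid_density_itv A)).
apply: W_infty; apply: filterS (Ac e e0) => m.
exact: (ultralimit_le_cst (fun t => grid_frequency_itv A m (grid_size t m))).
Qed.

Lemma time_density_content : is_content time_density.
Proof.
split.
- by move=> A; case/andP: (time_density_itv A).
- rewrite /time_density; apply: ultralimit_eq; apply: nearW => m.
  rewrite /grid_density; apply: ultralimit_eq.
  apply: filterS (near_grid_size m 1) => t N0; rewrite /grid_frequency /grid_count.
  rewrite (eq_bigr (fun=> 1%N)); last by move=> k _; rewrite in_setT.
  by rewrite sum1_card card_ord divff// pnatr_eq0 -lt0n.
- move=> A B AB0; rewrite -(ultralimitD (grid_density_itv A) (grid_density_itv B)).
  congr (ultralimit W _); apply/funext => m.
  rewrite -(ultralimitD (fun t => grid_frequency_itv A m (grid_size t m)) 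
    (fun t => grid_frequency_itv B m (grid_size t m))).
  congr (ultralimit U _); apply/funext => t /=.
  rewrite /grid_frequency -mulrDl -natrD; congr (_%:R / _).
  rewrite /grid_count -big_split/=; apply: eq_bigr => k _; rewrite in_setU.
  have [/set_mem Ak|_] := boolP (_ \in A); last by rewrite add0n.
  have [/set_mem Bk|//] := boolP (_ \in B).
  by have : (A `&` B) (k%:R / m.+1%:R) by []; rewrite AB0.
Qed.

Lemma time_density_null (A : set R) :
  (forall m, null_density [set k | A (k%:R / m.+1%:R)]) -> time_density A = 0.
Proof.
move=> Anull; apply/eqP; rewrite eq_le (content_ge0 time_density_content) andbT.
apply: time_density_le_cst.
move=> e e0; apply: nearW => m; rewrite add0r.
pose l := (Num.truncn e^-1).+1.
have el : l%:R^-1 <= e.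
  by rewrite -[leRHS]invrK lef_pV2 ?posrE ?ltr0n ?invr_gt0// ltW// truncnS_gt.
have [n _ nP] := Anull m l.
apply: filterS (near_grid_size m n.+1) => t nt; apply: (le_trans _ el).
have N0 : (0 < grid_size t m)%N by exact: leq_trans nt.
rewrite ler_pdivrMr ?ltr0n// mulrC ler_pdivlMr ?ltr0n// -natrM ler_nat.
by have := nP _ (ltnW nt).
Qed.

Lemma near_natr_div (c : nat) (e : R) : 0 < e ->
  \forall N \near \oo, (0 < N)%N /\ c%:R / N%:R <= e.
Proof.
move=> e0; near=> N; have N0 : (0 < N)%N by near: N; exact: nbhs_infty_gt.
split => //; rewrite ler_pdivrMr ?ltr0n// mulrC -ler_pdivrMr//.
by near: N; exact: nbhs_infty_ger.
Unshelve. all: by end_near. Qed.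

(** Shifting the indices by c changes a count by at most c, which is
    negligible compared with the length of the grid. *)
Lemma time_density_shift (A B : set R) (c : nat -> nat) :
  (\forall m \near \oo, forall k : nat,
    A (k%:R / m.+1%:R) -> B ((k + c m)%:R / m.+1%:R)) ->
  time_density A <= time_density B.
Proof.
move=> AB; apply: time_density_le => e e0; apply: filterS AB => m AB.
apply: filterS (near_natr_div (c m) e0) => N [N0 cN].
rewrite /grid_frequency; apply: (le_trans _ (lerD (lexx _) cN)).
rewrite -mulrDl ler_pM2r ?invr_gt0 ?ltr0n// -natrD ler_nat.
apply: (@leq_trans (grid_count B m (c m + N))).
  rewrite /grid_count big_split_ord/=; apply: leq_trans (leq_addl _ _).
  apply: leq_sum => k _; have [/set_mem/AB/mem_set|//] := boolP (_ \in A).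
  by rewrite addnC => ->.
rewrite addnC /grid_count big_split_ord/= leq_add2l.
rewrite -[leqRHS]card_ord -sum1_card; apply: leq_sum => k _.
by case: (_ \in _).
Qed.

Lemma time_density_shiftV (A B : set R) (c : nat -> nat) :
  (\forall m \near \oo, forall k : nat,
    A ((k + c m)%:R / m.+1%:R) -> B (k%:R / m.+1%:R)) ->
  time_density A <= time_density B.
Proof.
move=> AB; apply: time_density_le => e e0; apply: filterS AB => m AB.
apply: filterS (near_natr_div (c m) e0) => N [N0 cN].
rewrite /grid_frequency; apply: (le_trans _ (lerD (lexx _) cN)).
rewrite -mulrDl ler_pM2r ?invr_gt0 ?ltr0n// -natrD ler_nat.
apply: (@leq_trans (grid_count A m (c m + N))).
  by rewrite addnC /grid_count big_split_ord/= leq_addr.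
rewrite /grid_count big_split_ord/= addnC; apply: leq_add.
  apply: leq_sum => k _; have [/set_mem + |//] := boolP (_ \in A).
  by rewrite addnC => /AB/mem_set ->.
rewrite -[leqRHS]card_ord -sum1_card; apply: leq_sum => k _.
by case: (_ \in _).
Qed.

(** For a fine grid, translation by u is a shift by an integer number of
    steps up to an error smaller than eta. *)
Lemma time_density_translate (A B : set R) (u eta : R) : 0 < eta ->
  (forall r r', 0 <= r -> 0 <= r' -> `|r' - (r + u)| < eta -> A r -> B r') ->
  time_density A <= time_density B.
Proof.
move=> eta0 AB; have truncn_close v m : 0 <= v -> m.+1%:R^-1 < eta ->
    `|v - (Num.truncn (v * m.+1%:R))%:R / m.+1%:R| < eta.
  move=> v0 meta; have m0 : 0 < m.+1%:R :> R by rewrite ltr0n.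
  have /andP[h1 h2] := truncn_itv (mulr_ge0 v0 (ltW m0)).
  rewrite ger0_norm ?subr_ge0 ?ler_pdivrMr//; apply: lt_trans meta.
  by rewrite ltrBlDr -[X in _ < X + _]mul1r -mulrDl ltr_pdivlMr// addrC natr1.
have [u0|u0] := leP 0 u.
  apply: (@time_density_shift A B (fun m => Num.truncn (u * m.+1%:R))).
  apply: filterS (near_infty_natSinv_lt (PosNum eta0)) => m meta k.
  apply: AB; rewrite ?divr_ge0// natrD mulrDl opprD addrACA subrr add0r distrC.
  exact: truncn_close.
apply: (@time_density_shiftV A B (fun m => Num.truncn (- u * m.+1%:R))).
apply: filterS (near_infty_natSinv_lt (PosNum eta0)) => m meta k.
apply: AB; rewrite ?divr_ge0// natrD mulrDl -addrA opprD addrA subrr add0r opprD.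
by rewrite addrC truncn_close// oppr_ge0 ltW.
Qed.

(** Each grid point of A contributes a whole cell to K. *)
Lemma grid_count_le_measure (A K : set R) (m N : nat) : measurable K ->
  (forall k : nat, A (k%:R / m.+1%:R) -> forall s,
    k%:R / m.+1%:R <= s -> s <= k.+1%:R / m.+1%:R -> K s) ->
  (((grid_count A m N)%:R / m.+1%:R)%:E <=
    lebesgue_measure (`[0%R, (N%:R / m.+1%:R)%R] `&` K))%E.
Proof.
move=> mK AK; elim: N => [|N IH].
  by rewrite /grid_count big_ord0 mul0r measure_ge0.
pose a : R := N%:R / m.+1%:R; pose b : R := N.+1%:R / m.+1%:R.
have a0 : 0 <= a by rewrite divr_ge0.
have ba : b - a = m.+1%:R^-1.
  by rewrite /a /b -mulrBl -natr1 addrC addKr mul1r.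
have ab : a < b by rewrite -subr_gt0 ba invr_gt0 ltr0n.
have -> : `[0, b]%classic = `[0, a]%classic `|` `]a, b]%classic.
  by rewrite -itv_bndbnd_setU// bnd_simp ltW.
rewrite setIUl measureU; [|exact: measurableI|exact: measurableI|]; last first.
  rewrite -subset0 => s [[/= + _] [/= + _]]; rewrite !in_itv/=.
  by move=> /andP[_ sa] /andP[+ _]; rewrite ltNge sa.
rewrite /grid_count big_ord_recr/= natrD mulrDl EFinD; apply: leeD; first exact: IH.
have [/set_mem Aa|_] := boolP (_ \in A); last by rewrite mul0r measure_ge0.
rewrite (@setIidl _ `]a, b]%classic) => [|s /=]; last first.
  by rewrite in_itv/= => /andP[sa sb]; apply: (AK N) => //; exact: ltW.
by rewrite lebesgue_measure_itv/= lte_fin ab -EFinB lee_fin mul1r ba.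
Qed.

Lemma time_density_le_occupation (A K : set R) (c : R) : measurable K ->
  (\forall m \near \oo, forall k : nat, A (k%:R / m.+1%:R) -> forall s,
    k%:R / m.+1%:R <= s -> s <= k.+1%:R / m.+1%:R -> K s) ->
  (forall e, 0 < e -> \forall t \near U,
    (t^-1%:E * lebesgue_measure (`[0%R, t] `&` K) <= (c + e)%:E)%E) ->
  time_density A <= c.
Proof.
move=> mK AK Kc; apply: time_density_le_cst => // e e0.
have e20 : 0 < e / 2 by rewrite divr_gt0.
apply: filterS AK => m AK.
have [n _ nP] := near_natr_div 1 e20.
have tU : \forall t \near U, 0 < t by apply: U_infty; exact: nbhs_pinfty_gt.
have KU := Kc _ e20.
near=> t.
have t0 : 0 < t by near: t.
have Kt : (t^-1%:E * lebesgue_measure (`[0%R, t] `&` K) <= (c + e / 2)%:E)%E.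
  by near: t; exact: KU.
have mt0 : 0 < m.+1%:R :> R by rewrite ltr0n.
have [N0 Ne] : (0 < grid_size t m)%N /\ 1%:R / (grid_size t m)%:R <= e / 2.
  by apply: nP => /=; near: t; exact: near_grid_size.
set N := grid_size t m in N0 Ne *.
have Nt : N%:R / m.+1%:R <= t.
  by rewrite ler_pdivrMr// truncn_le mulr_ge0// ltW.
have tN : t * m.+1%:R <= N%:R + 1 by rewrite natr1 ltW// truncnS_gt.
have mtK : measurable (`[0%R, t]%classic `&` K) by exact: measurableI.
have K_le : (lebesgue_measure (`[0%R, t]%classic `&` K) <= t%:E)%E.
  apply: (@le_trans _ _ (lebesgue_measure `[0%R, t]%classic)).
    apply: le_measure; [exact/mem_set| |exact: subIsetl].
    by apply/mem_set; exact: measurable_itv.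
  by rewrite lebesgue_measure_itv/= lte_fin t0 oppr0 adde0.
have K_fin : lebesgue_measure (`[0%R, t]%classic `&` K) \is a fin_num.
  by rewrite ge0_fin_numE ?measure_ge0// (le_lt_trans K_le)// ltry.
set q := fine (lebesgue_measure (`[0%R, t]%classic `&` K)).
have qE : lebesgue_measure (`[0%R, t]%classic `&` K) = q%:E by rewrite fineK.
have count_le : (grid_count A m N)%:R / m.+1%:R <= q.
  rewrite -lee_fin -qE; apply: (le_trans (grid_count_le_measure N mK AK)).
  apply: le_measure; [|exact/mem_set|].
    by apply/mem_set; exact: measurableI.
  by apply: setSI => s /=; rewrite !in_itv/= => /andP[-> sN]; exact: le_trans sN Nt.
have qt : q <= t by rewrite -lee_fin -qE.
have q0 : 0 <= q by rewrite fine_ge0// measure_ge0.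
have qc : q / t <= c + e / 2 by rewrite mulrC -lee_fin EFinM -qE.
have qt1 : q / t <= 1 by rewrite ler_pdivrMr// mul1r.
have N0' : 0 < N%:R :> R by rewrite ltr0n.
move: Ne; rewrite /grid_frequency !ler_pdivrMr// => Ne.
move: count_le; rewrite ler_pdivrMr// => /le_trans; apply.
have -> : q * m.+1%:R = (t * m.+1%:R) * (q / t) by field; rewrite gt_eqF.
have h : (t * m.+1%:R) * (q / t) <= (N%:R + 1) * (q / t).
  by rewrite ler_wpM2r// divr_ge0// ltW.
have h' : N%:R * (q / t) <= N%:R * (c + e / 2) by rewrite ler_wpM2l// ltW.
lra.
Unshelve. all: by end_near. Qed.

End time_density.

(** * Occupation measures of a path *)

Section set_function_integral.
Context {d : measure_display} {T : measurableType d} {R : realType}.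
Import HBNNSimple.

(** The integral only evaluates the set function on level sets of simple
    functions. This applies to occupation measures, which agree with a
    measure on Borel sets only. *)
Lemma eq_measurable_integral (m1 m2 : set T -> \bar R) (D : set T)
    (f : T -> \bar R) : (forall A, measurable A -> m1 A = m2 A) ->
  (\int[m1]_(x in D) f x = \int[m2]_(x in D) f x)%E.
Proof.
move=> m12; have sint h : measurable_fun setT h -> sintegral m1 h = sintegral m2 h.
  move=> mh; rewrite !sintegralET; apply: eq_fsbigr => x _; rewrite m12//.
  by rewrite -[X in measurable X]setTI; exact: mh.
rewrite /integral; congr (ereal_sup _ - ereal_sup _)%E; apply: eq_imagel => h _;
  exact: sint.
Qed.

End set_function_integral.

Section occupation.
Context {R : realType} {M : pmetricType R}.

Lemma measurable_continuousType (g : continuousType M R) :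
  measurable_fun setT (fun z : borel M => (g z)%:E).
Proof.
have gcont : continuous g by exact: cts_fun.
apply/measurable_EFinP.
apply: (@measurability _ _ (borel M) R setT g (@RGenOInfty.G R)).
  exact: RGenOInfty.measurableE.
move=> _ [_ [r ->] <-]; rewrite setTI; apply: borel_open.
by apply: open_comp => [z _|]; [exact: gcont|exact: interval_open].
Qed.

Lemma integral_functional_le_measure (mu : probability (borel M) R) (G : set M)
    (g : continuousType M R) : open G -> (forall z, 0 <= g z <= 1) ->
  (forall z, ~ G z -> g z = 0) ->
  ((integral_functional mu g)%:E <= mu G)%E.
Proof.
move=> oG g01 gG; have mG : measurable (G : set (borel M)) by exact: borel_open.
have mg := measurable_continuousType g.
have g0 z : (0 <= (g z)%:E)%E by rewrite lee_fin; case/andP: (g01 z).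
have I_le : (\int[mu]_(z in setT) (g z)%:E <= mu G)%E.
  rewrite -[X in mu X]setIT -integral_indic//; apply: ge0_le_integral => //.
  - apply/measurable_EFinP; exact: measurable_indic.
  - move=> z _; rewrite lee_fin indicE; have [_|/negP nGz] := boolP (z \in G).
      by case/andP: (g01 z).
    by rewrite gG// => Gz; apply: nGz; exact/mem_set.
rewrite /integral_functional fineK//.
rewrite ge0_fin_numE; last exact: integral_ge0.
by rewrite (le_lt_trans I_le)// (le_lt_trans (probability_le1 _ _))// ltry.
Qed.
Variables (x y : R -> M).
Hypotheses (y_continuous : continuous y) (xy : forall s, 0 <= s -> x s = y s).

Lemma measurable_path : measurable_fun setT (y : measurableTypeR R -> borel M).
Proof.
apply: (@measurability _ _ (measurableTypeR R) (borel M) setT y (@open M)) => //.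
move=> _ [U oU <-]; rewrite setTI; apply: open_measurable.
by apply: open_comp => // s _; exact: y_continuous.
Qed.

Lemma occupation_measureE (t : R) (A : set (borel M)) : measurable A ->
  occupation_measure x t A =
  (t^-1%:E * lebesgue_measure (`[0%R, t] `&` y @^-1` A))%E.
Proof.
move=> mA; congr (_ * _)%E.
have mK : measurable (y @^-1` A).
  by rewrite -[X in measurable X]setTI; exact: measurable_path.
rewrite setIC -integral_indic//; apply: eq_integral => s /set_mem /=.
by rewrite in_itv/= => /andP[s0 _]; rewrite xy// diracE indicE.
Qed.

(** The indicator function of C is at most g. *)
Lemma occupation_le_integral_functional (t : R) (C : set M)
    (g : continuousType M R) : 0 < t -> closed C -> (forall z, 0 <= g z <= 1) ->
  (forall z, C z -> g z = 1) ->
  (t^-1%:E * lebesgue_measure (`[0%R, t] `&` y @^-1` C) <=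
    (integral_functional (occupation_measure x t) g)%:E)%E.
Proof.
move=> t0 cC g01 gC.
have mI : measurable (`[0%R, t]%classic : set (measurableTypeR R)) by [].
have tV0 : 0 <= t^-1 by rewrite invr_ge0 ltW.
pose m : {measure set (borel M) -> \bar R} :=
  mscale (NngNum tV0) (image_measure (mrestr (@lebesgue_measure R) mI) measurable_path).
have mE A : m A = (t^-1%:E * lebesgue_measure (`[0%R, t] `&` y @^-1` A))%E.
  by rewrite setIC.
have mC : measurable (C : set (borel M)) by exact: borel_closed.
have mT : m setT = 1%E.
  rewrite mE preimage_setT setIT lebesgue_measure_itv/= lte_fin t0 oppr0 adde0.
  by rewrite -EFinM mulVf// gt_eqF.
have mg := measurable_continuousType g.
rewrite /integral_functional (@eq_measurable_integral _ _ _ _ m); last first.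
  by move=> A mA; rewrite occupation_measureE// mE.
have g0 z : (0 <= (g z)%:E)%E by rewrite lee_fin; case/andP: (g01 z).
have I_le1 : (\int[m]_(z in setT) (g z)%:E <= 1)%E.
  rewrite -mT -[leRHS]mul1e -integral_cst//; apply: ge0_le_integral => //.
  by move=> z _; rewrite lee_fin; case/andP: (g01 z).
rewrite fineK; last first.
  rewrite ge0_fin_numE; first by rewrite (le_lt_trans I_le1)// ltry.
  exact: integral_ge0.
rewrite -mE -[X in m X]setTI setIC -integral_indic//; apply: ge0_le_integral => //.
- apply/measurable_EFinP; exact: measurable_indic.
- move=> z _; rewrite lee_fin indicE; have [/set_mem Cz|_] := boolP (z \in C).
    by rewrite gC.
  by case/andP: (g01 z).
Qed.

End occupation.

(** * A path tracked by entire solutions *)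

(** Makes a weak* limit point of the occupation measures, which is only a
    cluster point, into a limit along a filter of times. *)
Lemma cluster_ultrafilter {I : Type} {T : topologicalType} (F : set_system I)
    (h : I -> T) (p : T) : Filter F -> cluster (h @ F) p ->
  exists U : set_system I, [/\ UltraFilter U, F `<=` U & h @ U --> p].
Proof.
move=> FF clp.
pose B := filter_from [set AB : set I * set T | F AB.1 /\ nbhs p AB.2]
  (fun AB => AB.1 `&` h @^-1` AB.2).
have BP : ProperFilter B.
  apply: filter_from_proper; last first.
    move=> [A V] /= [FA pV]; have [|_ [[i Ai <-] Vi]] := clp (h @` A) V _ pV.
      by apply: (@filterS _ F _ A) => // i Ai; exists i.
    by exists i.
  apply: filter_from_filter; first by exists (setT, setT); split; exact: filterT.
  move=> [A V] [A' V'] /= [FA pV] [FA' pV'].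
  exists (A `&` A', V `&` V'); first by split; exact: filterI.
  by move=> i [[? ?] [? ?]].
have [U [UU BU]] := ultraFilterLemma BP.
exists U; split => //.
- move=> A FA; apply: BU; exists (A, setT); first by split => //; exact: filterT.
  by move=> i [].
- move=> V pV; apply: BU; exists (setT, V); first by split => //; exact: filterT.
  by move=> i [].
Qed.

Section shadowing.
Context {R : realType} {M : pmetricType R}.
Variables (Phi : R -> M -> set M) (x : R -> M).
Hypotheses (M_compact : compact [set: M]) (PhiP : is_svds Phi).
Hypothesis x_uniform : forall e : R, 0 < e -> exists2 delta : R, 0 < delta &
  forall s t : R, 0 <= s -> 0 <= t -> `|s - t| < delta -> mdist (x s) (x t) < e.
Hypothesis x_shadowed : forall (m T J : nat) (e : R), (0 < T)%N -> 0 < e ->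
  null_density [set k | ~ shadowed Phi T J e (fun s => x (k%:R / m.+1%:R + s))].
Notation S := (entire_solutions Phi).

(** The window and the precision improve together with n. *)
Definition tracked (n : nat) (r : R) : Prop := exists2 z, S z &
  uniformly_near n%:R n.+1%:R^-1 z (fun s => x (r + s)).

(** A solution that shadows the path from r at the points of a fine grid on
    [0, 2n+1] also shadows it in between, by equicontinuity; translated by
    n, it shadows the path on the symmetric window around r + n. *)
Lemma shadowed_tracked (n : nat) : exists (J : nat) (e : R), 0 < e /\
  forall r, 0 <= r -> shadowed Phi (n + n).+1 J e (fun s => x (r + s)) ->
    tracked n (r + n%:R).
Proof.
have e0 : 0 < n.+1%:R^-1 / 3 :> R by rewrite divr_gt0.
set e := n.+1%:R^-1 / 3 in e0.
have [d1 d10 H1] := x_uniform e0.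
have [d2 d20 H2] := entire_solution_equicontinuous M_compact PhiP e0.
have d0 : 0 < Num.min d1 d2 by rewrite lt_min d10.
have [J _ /(_ J (leqnn J)) /=] := near_infty_natSinv_lt (PosNum d0).
rewrite lt_min => /andP[J1 J2].
exists J, e; split => // r r0 [z Sz zP].
exists (translation n%:R z); first exact: translation_entire.
move=> s sn; rewrite /translation.
set u := n%:R + s.
have /andP[s_ge s_le] : - n%:R <= s <= n%:R by rewrite -ler_norml.
have u0 : 0 <= u by rewrite /u -lerBlDl sub0r.
have u2n : u <= (n + n)%:R by rewrite /u natrD lerD2l.
have -> : r + n%:R + s = r + u by rewrite addrA.
have J0 : 0 < J.+1%:R :> R by rewrite ltr0n.
pose j := Num.truncn (u * J.+1%:R); pose v : R := j%:R / J.+1%:R.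
have /andP[ju uj] := truncn_itv (mulr_ge0 u0 (ltW J0)).
have vu : v <= u by rewrite ler_pdivrMr.
have uv : u - v < J.+1%:R^-1.
  by rewrite ltrBlDr -[X in _ < X + _]mul1r -mulrDl ltr_pdivlMr// addrC natr1.
have v0 : 0 <= v by rewrite divr_ge0.
have jT : (j <= (n + n).+1 * J.+1)%N.
  rewrite -(ler_nat R); apply: (le_trans ju); rewrite natrM ler_wpM2r//.
  by apply: (le_trans u2n); rewrite ler_nat.
have zv : mdist (z u) (z v) < e.
  by apply: H2 => //; rewrite ger0_norm ?subr_ge0//; exact: lt_trans J2.
have xv : mdist (x (r + v)) (x (r + u)) < e.
  apply: H1; [exact: addr_ge0|exact: addr_ge0|].
  rewrite opprD addrACA subrr add0r distrC ger0_norm ?subr_ge0//.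
  exact: lt_trans J1.
have := zP j jT; rewrite -/v => zx.
have := metric_triangle (z u) (z v) (x (r + u)).
have := metric_triangle (z v) (x (r + v)) (x (r + u)).
have -> : n.+1%:R^-1 = e + e + e by rewrite /e; field.
lra.
Qed.

(** At time r follow a solution which is good for the largest n up to r for
    which there is one; it is then good for all smaller n. *)
Lemma exists_tracking (z0 : S) : exists zz : R -> S, forall (n : nat) r,
  n%:R <= r -> tracked n r ->
  uniformly_near n%:R n.+1%:R^-1 (set_val (zz r)) (fun s => x (r + s)).
Proof.
have tr r (N : nat) : exists z : S, forall n : nat, (n <= N)%N -> tracked n r ->
    uniformly_near n%:R n.+1%:R^-1 (set_val z) (fun s => x (r + s)).
  have near_le (n n' : nat) z : (n <= n')%N ->
      uniformly_near n'%:R n'.+1%:R^-1 z (fun s => x (r + s)) ->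
      uniformly_near n%:R n.+1%:R^-1 z (fun s => x (r + s)).
    move=> nn' zx s sn; apply: (lt_le_trans (zx s _)).
      by apply: (le_trans sn); rewrite ler_nat.
    by rewrite lef_pV2 ?posrE ?ltr0n// ler_nat ltnS.
  elim: N => [|N [z IH]].
    have [[z Sz zx]|nt] := pselect (tracked 0 r).
      by exists (SigSub (mem_set Sz)) => n; rewrite leqn0 => /eqP ->.
    by exists z0 => n; rewrite leqn0 => /eqP ->.
  have [[z' Sz' zx]|nt] := pselect (tracked N.+1 r).
    by exists (SigSub (mem_set Sz')) => n nN _; exact: near_le zx.
  exists z => n; rewrite leq_eqVlt ltnS => /orP[/eqP -> //|]; exact: IH.
have /choice[zz zzP] : forall r, exists z : S, forall n : nat,
    (n <= Num.truncn r)%N -> tracked n r ->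
    uniformly_near n%:R n.+1%:R^-1 (set_val z) (fun s => x (r + s)).
  by move=> r; exact: tr.
exists zz => n r nr; apply: zzP; rewrite truncn_ge_nat//.
by apply: le_trans nr; exact: ler0n.
Qed.

Section tracking_density.
Variables (U : set_system R) (W : set_system nat).
Context {UU : UltraFilter U} {WU : UltraFilter W}.
Hypotheses (U_infty : pinfty_nbhs R `<=` U) (W_infty : \oo `<=` W).
Notation density := (time_density U W).

Lemma density_lt (n : nat) : density [set r | r < n%:R] = 0.
Proof.
apply/eqP; rewrite eq_le (content_ge0 (time_density_content U_infty)) andbT.
rewrite -(content_set0 (time_density_content (W := W) U_infty)).
apply: (@time_density_shiftV _ _ _ _ _ U_infty W_infty _ _ (fun m => n * m.+1)%N).
apply: nearW => m k /=; rewrite ltr_pdivrMr ?ltr0n// -natrM ltr_nat.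
by rewrite ltnNge leq_addl.
Qed.

Lemma density_untracked (n : nat) : density [set r | ~ tracked n r] = 0.
Proof.
have [J [e [e0 H]]] := shadowed_tracked n.
apply/eqP; rewrite eq_le (content_ge0 (time_density_content U_infty)) andbT.
apply: (@le_trans _ _ (density
    [set r | ~ shadowed Phi (n + n).+1 J e (fun s => x (r + s))])).
  apply: (@time_density_shiftV _ _ _ _ _ U_infty W_infty _ _ (fun m => n * m.+1)%N).
  apply: nearW => m k /= + sh; apply.
  by rewrite natrD mulrDl natrM mulfK ?pnatr_eq0//; apply: H sh; rewrite divr_ge0.
rewrite (time_density_null U_infty W_infty)// => m.
exact: x_shadowed.
Qed.

(** If there were no entire solutions then all times would be untracked. *)
Lemma inhabited_solutions : inhabited S.
Proof.
apply: contrapT => S0; have := density_untracked 0.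
have -> : [set r | ~ tracked 0 r] = setT.
  apply/seteqP; split => // r _ [z Sz _]; apply: S0.
  exact: (inhabits (SigSub (mem_set Sz))).
by rewrite (content_setT (time_density_content U_infty)) => /eqP; rewrite oner_eq0.
Qed.

Variable zz : R -> S.
Hypothesis zzP : forall (n : nat) r, n%:R <= r -> tracked n r ->
  uniformly_near n%:R n.+1%:R^-1 (set_val (zz r)) (fun s => x (r + s)).

(** Early times are included so that, off this set, all windows of
    half-length T stay in nonnegative times. *)
Definition off_track (T e : R) : set R := [set r | r < T \/
  ~ uniformly_near T e (set_val (zz r)) (fun s => x (r + s))].

Lemma density_off_track (T e : R) : 0 < e -> density (off_track T e) = 0.
Proof.
move=> e0; have dP : is_content density by exact: time_density_content.
have [n [Tn ne]] : exists n : nat, T <= n%:R /\ n.+1%:R^-1 < e.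
  have [n _ nP] := filterI (nbhs_infty_ger T) (near_infty_natSinv_lt (PosNum e0)).
  by exists n; exact: (nP n (leqnn n)).
apply/eqP; rewrite eq_le (content_ge0 dP) andbT.
apply: (@le_trans _ _ (density ([set r | r < n%:R] `|` [set r | ~ tracked n r]))).
  apply: (content_le dP) => r [rT|nn]; first by left; exact: lt_le_trans Tn.
  apply: contrapT => /not_orP[/negP]; rewrite -leNgt => nr /contrapT tr.
  apply: nn => s sT; apply: lt_trans ne; apply: zzP => //.
  exact: le_trans Tn.
apply: (le_trans (content_subU dP _ _)).
by rewrite density_lt density_untracked addr0.
Qed.

Lemma density_le_off_track (T e : R) (A B : set R) : 0 < e ->
  A `\` off_track T e `<=` B -> density A <= density B.
Proof.
move=> e0 AB; have dP : is_content density by exact: time_density_content.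
apply: (@le_trans _ _ (density (B `|` off_track T e))).
  apply: (content_le dP) => r Ar.
  by have [|nr] := pselect (off_track T e r); [right|left; apply: AB].
by apply: (le_trans (content_subU dP _ _)); rewrite density_off_track// addr0.
Qed.

(** The distribution of the tracking solution at a random time. *)
Definition solution_content (A : set S) : R := density [set r | A (zz r)].

Lemma solution_content_is_content : is_content solution_content.
Proof.
have dP : is_content density by exact: time_density_content.
split.
- by move=> A; exact: (content_ge0 dP).
- exact: (content_setT dP).
- move=> A B AB; rewrite -(content_setU dP)//.
  by rewrite -subset0 => r ABr; have : (A `&` B) (zz r) by []; rewrite AB.
Qed.

(** Outside a set of density zero, the solution tracking at r, translated by
    u, is near the path at r + u, hence near the solution tracking at a grid
    time r' close to r + u. *)
Lemma solution_content_translation (u : R) (A B : set S) (T e : R) : 0 < e ->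
  (forall z z' : S, A z -> uniformly_near T e (set_val z) (set_val z') -> B z') ->
  solution_content (solution_translation u @^-1` A) <= solution_content B.
Proof.
move=> e0 AB; have e30 : 0 < e / 3 by rewrite divr_gt0.
have [eta eta0 x_eta] := x_uniform e30.
pose K := `|T| + `|u| + 1.
pose A' := [set r | A (solution_translation u (zz r))] `\` off_track K (e / 3).
pose B' := [set r | B (zz r) \/ off_track K (e / 3) r].
apply: (@le_trans _ _ (density A')).
  apply: (@density_le_off_track K (e / 3)) => //.
apply: (@le_trans _ _ (density B')); last first.
  apply: (@density_le_off_track K (e / 3)) => //.
  by move=> r [[]].
apply: (@time_density_translate _ _ _ _ _ U_infty W_infty _ _ u (Num.min eta 1)).
  by rewrite lt_min eta0 ltr01.
move=> r r' r0 r'0; rewrite lt_min => /andP[rr'eta rr'1] [Ar on_r].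
have [|on_r'] := pselect (off_track K (e / 3) r'); first by right.
left; apply: (AB _ _ Ar) => s sT.
move: on_r => /not_orP[/negP]; rewrite -leNgt => Kr /contrapT near_r.
move: on_r' => /not_orP[/negP]; rewrite -leNgt => Kr' /contrapT near_r'.
have sT' : `|s| <= `|T| by apply: (le_trans sT); exact: ler_norm.
have h1 : mdist (set_val (zz r) (u + s)) (x (r + (u + s))) < e / 3.
  apply: near_r; apply: (le_trans (ler_normD _ _)); rewrite /K; lra.
have h2 : mdist (set_val (zz r') s) (x (r' + s)) < e / 3.
  by apply: near_r'; apply: (le_trans sT'); rewrite /K -addrA lerDl addr_ge0.
have h3 : mdist (x (r + (u + s))) (x (r' + s)) < e / 3.
  have /andP[s_ge _] : - `|s| <= s <= `|s| by rewrite -ler_norml.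
  have /andP[u_ge _] : - `|u| <= u <= `|u| by rewrite -ler_norml.
  apply: x_eta.
  - move: Kr; rewrite /K; lra.
  - move: Kr'; rewrite /K; have := normr_ge0 u; lra.
  - rewrite addrA opprD addrACA subrr addr0 distrC//.
have := metric_triangle (set_val (zz r) (u + s)) (x (r + (u + s))) (set_val (zz r') s).
have := metric_triangle (x (r + (u + s))) (x (r' + s)) (set_val (zz r') s).
rewrite (metric_sym (x (r' + s))) /=; lra.
Qed.

End tracking_density.
End shadowing.

(** * Weak limits of occupation measures *)

Section occupation_limits.
Context {R : realType} {M : pmetricType R}.
Variables (Phi : R -> M -> set M) (x : R -> M).
Hypotheses (M_compact : compact [set: M]) (PhiP : is_svds Phi).
Hypothesis x_uniform : forall e : R, 0 < e -> exists2 delta : R, 0 < delta &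
  forall s t : R, 0 <= s -> 0 <= t -> `|s - t| < delta -> mdist (x s) (x t) < e.
Hypothesis x_shadowed : forall (m T J : nat) (e : R), (0 < T)%N -> 0 < e ->
  null_density [set k | ~ shadowed Phi T J e (fun s => x (k%:R / m.+1%:R + s))].
Notation S := (entire_solutions Phi).

(** Extends the path to negative times by a constant, which makes it
    continuous, hence measurable, on the whole line. *)
Definition stopped_path (s : R) : M := x (Num.max 0 s).

Lemma stopped_path_continuous : continuous stopped_path.
Proof.
move=> s B /nbhs_ballP[e /= e0 eB]; have [delta d0 H] := x_uniform e0.
apply/nbhs_ballP; exists delta => //= t; rewrite /ball/= => st; apply: eB.
rewrite ballEmdist /=; apply: H; rewrite ?le_max ?lexx//.
apply: le_lt_trans st.
have /andP[st_ge st_le] : - `|s - t| <= s - t <= `|s - t| by rewrite -ler_norml.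
rewrite ler_norml; have [s0|s0] := leP 0 s; have [t0|t0] := leP 0 t;
  apply/andP; split; lra.
Qed.

Lemma stopped_pathE s : 0 <= s -> x s = stopped_path s.
Proof. by move=> s0; rewrite /stopped_path max_r. Qed.

Lemma separating_function (C G : set M) : closed C -> open G -> C `<=` G ->
  exists g : continuousType M R, [/\ forall z, 0 <= g z <= 1,
    forall z, C z -> g z = 1 & forall z, ~ G z -> g z = 0].
Proof.
move=> cC oG CG.
have M_normal := compact_normal (@metric_hausdorff _ M) M_compact.
have sep : uniform_separator (~` G) C.
  apply: (normal_separatorP (R := R)).1 => //; first exact: open_closedC.
  by rewrite -subset0 => z [nG Cz]; apply: nG; exact: CG.
exists (mkcts (@Urysohn_continuous M R (~` G) C)); split => z.
- have : range (@Urysohn M R (~` G) C) (Urysohn (~` G) C z) by exists z.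
  by move=> /Urysohn_range/=; rewrite in_itv.
- move=> Cz; have : (@Urysohn M R (~` G) C @` C) (Urysohn (~` G) C z) by exists z.
  by move=> /(Urysohn_sub1 sep).
- move=> nG; have : (@Urysohn M R (~` G) C @` ~` G) (Urysohn (~` G) C z) by exists z.
  by move=> /(Urysohn_sub0 sep).
Qed.

Section tracking.
Variables (U : set_system R) (W : set_system nat).
Context {UU : UltraFilter U} {WU : UltraFilter W}.
Hypotheses (U_infty : pinfty_nbhs R `<=` U) (W_infty : \oo `<=` W).
Variable (zz : R -> S).
Hypothesis zzP : forall (n : nat) r, n%:R <= r -> tracked Phi x n r ->
  uniformly_near n%:R n.+1%:R^-1 (set_val (zz r)) (fun s => x (r + s)).

(** When the solution tracking at a grid time t starts near C, the path
    stays near C on the following cell of the grid. So the frequency of such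
    times is at most the occupation measure of a neighborhood of C, which in
    the limit is bounded by the integral of a continuous function supported
    near C. *)
Lemma solution_content_evaluation_le (mu : probability (borel M) R) (C : set M)
    (r : R) : 0 < r ->
  (forall g : continuousType M R,
    integral_functional (occupation_measure x t) g @[t --> U]
      --> integral_functional mu g) ->
  ((solution_content U W zz
     [set z | enlargement C (r / 4) (set_val z 0)])%:E <= mu (enlargement C r))%E.
Proof.
move=> r0 mu_lim; have r40 : 0 < r / 4 by rewrite divr_gt0.
set rho := r / 4 in r40 *.
have rE : r = rho + rho + rho + rho by rewrite /rho; field.
(* The radius grows by rho three times: for the tracking error, for the motion
   of the path within a grid cell, and for taking a closure. *)
pose C3 := closure (enlargement C (rho + rho + rho)).
have [g [g01 gC gG]] : exists g : continuousType M R, [/\ forall z, 0 <= g z <= 1,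
    forall z, C3 z -> g z = 1 & forall z, ~ enlargement C r z -> g z = 0].
  apply: separating_function; first exact: closed_closure.
    exact: open_enlargement.
  by rewrite rE; exact: closure_enlargement.
have [delta d0 x_delta] := x_uniform r40.
apply: le_trans (integral_functional_le_measure mu (open_enlargement C r) g01 gG).
rewrite lee_fin.
pose A := [set t | 0 <= t /\ enlargement C (rho + rho) (x t)].
apply: (@le_trans _ _ (time_density U W A)).
  apply: (@density_le_off_track _ _ _ _ M_compact PhiP x_uniform x_shadowed
    _ _ _ _ U_infty W_infty zz zzP 0 rho) => // t [Vt].
  move=> /not_orP[/negP]; rewrite -leNgt => t0 /contrapT near_t.
  split => //; apply: (enlargementD Vt).
  by have := near_t 0; rewrite normr0 addr0; apply.
have cC3 : closed C3 by exact: closed_closure.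
apply: (@time_density_le_occupation _ _ _ _ _ U_infty W_infty A (stopped_path @^-1` C3)).
- rewrite -[X in measurable X]setTI.
  apply: (measurable_path stopped_path_continuous) => //; exact: borel_closed.
- apply: filterS (near_infty_natSinv_lt (PosNum d0)) => m md k [k0 Ak] s ks sk.
  apply: subset_closure; apply: (enlargementD Ak).
  have s0 : 0 <= s by exact: le_trans ks.
  rewrite -stopped_pathE//; apply: x_delta => //.
  rewrite distrC ger0_norm ?subr_ge0//; apply: le_lt_trans md.
  by rewrite lerBlDr (le_trans sk)// -natr1 mulrDl mul1r addrC.
- move=> e e0; have ce : integral_functional mu g < integral_functional mu g + e.
    by rewrite ltrDl.
  have t_gt0 : \forall t \near U, 0 < t by apply: U_infty; exact: nbhs_pinfty_gt.
  have g_le := cvgr_le _ (mu_lim g) _ ce.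
  near=> t; have t0 : 0 < t by near: t.
  apply: (le_trans (occupation_le_integral_functional stopped_path_continuous
    stopped_pathE t0 cC3 g01 gC)).
  by rewrite lee_fin; near: t; exact: g_le.
Unshelve. all: by end_near. Qed.

End tracking.

(** Both identities between measures reduce to closed sets C. For these, the
    value of nu on an open neighborhood is at most its content, the content
    is compared by tracking with that of a slightly larger closed set, and
    this is at most its nu-measure. *)
Lemma occupation_limit_invariant :
  occupation_limits x `<=` invariant_measures Phi.
Proof.
move=> mu mu_lim.
have pinfty_filter : ProperFilter (pinfty_nbhs R) by exact: proper_pinfty_nbhs.
have [U [UU U_infty mu_U]] := cluster_ultrafilter pinfty_filter mu_lim.
have [W [WU W_infty]] := ultraFilterLemma eventually_filter.
have [z0] := inhabited_solutions M_compact PhiP x_uniform x_shadowed U_infty W_infty.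
have [zz zzP] := exists_tracking x z0.
have mP : is_content (solution_content U W zz).
  exact: solution_content_is_content.
have [nu [nu_open nu_closed nu_regular]] :=
  @regular_probability_of_content R (pointed_at z0) (solution_content U W zz)
    mP (@hausdorff_solution_space _ _ Phi) (compact_solution_space M_compact PhiP).
have mu_g (g : continuousType M R) :
    integral_functional (occupation_measure x t) g @[t --> U]
      --> integral_functional mu g.
  exact: (cvg_comp _ _ mu_U (@proj_continuous _ _ g (integral_functional mu))).
exists z0, nu.
have translation_continuous u :
    continuous (solution_translation u : pointed_at z0 -> pointed_at z0).
  exact: solution_translation_continuous.
have translation_le u (C : set (pointed_at z0)) : closed C ->
    (nu (solution_translation u @^-1` C) <= nu C)%E.
  move=> cC; apply/lee_addgt0Pr => e e0.
  have [G [oG CG Ge]] := nu_regular C e e0.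
  have [T [r [r0 rG]]] := closed_sub_open_uniform M_compact PhiP cC oG CG.
  (* An open V and a closed D are inserted between C and G, with room rho
     between V and D for the tracking error, and more for taking a closure. *)
  pose rho := r / 4; have rho0 : 0 < rho by rewrite divr_gt0.
  have rE : r = rho + rho + rho + rho by rewrite /rho; field.
  pose E (a : R) : set (pointed_at z0) := [set z' | exists2 z, C z &
    uniformly_near T a (set_val (z : S)) (set_val (z' : S))].
  have ED a b (z z' : S) : E a z -> uniformly_near T b (set_val z) (set_val z') ->
      E (a + b) z'.
    move=> [w Cw wz] zz'; exists w => // s sT.
    apply: (le_lt_trans (metric_triangle _ (set_val z s) _)).
    by apply: ltrD; [exact: wz|exact: zz'].
  pose V := interior (E rho).
  have CV : C `<=` V.
    by move=> z Cz; apply/nbhs_solutionP; exists T, rho; split => // z' zz'; exists z.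
  pose D := closure (E (rho + rho)).
  have DG : D `<=` G.
    move=> z Dz; have nz : nbhs (z : S)
        [set z' : S | uniformly_near T rho (set_val z) (set_val z')].
      by apply/nbhs_solutionP; exists T, rho.
    have [z' [Ez' zz']] := Dz _ nz.
    have [w Cw wz'] := Ez'; apply: (rG w) => // s sT.
    have := metric_triangle (set_val w s) (set_val (z' : S) s) (set_val (z : S) s).
    have := wz' s sT; have := zz' s sT.
    rewrite (metric_sym (set_val (z : S) s)) rE; lra.
  have oV : open (V : set (pointed_at z0)) by exact: open_interior.
  have cD : closed (D : set (pointed_at z0)) by exact: closed_closure.
  have oTV : open (solution_translation u @^-1` V : set (pointed_at z0)).
    by apply: open_comp => // z _; exact: translation_continuous.
  have cTC : closed (solution_translation u @^-1` C : set (pointed_at z0)).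
    by apply: closed_comp => // z _; exact: translation_continuous.
  apply: (@le_trans _ _ (nu (solution_translation u @^-1` V))).
    apply: le_measure.
    - by apply/mem_set; exact: borel_closed.
    - by apply/mem_set; exact: borel_open.
    - exact: preimage_subset.
  apply: (le_trans (nu_open _ oTV)).
  apply: (@le_trans _ _ (solution_content U W zz D)%:E).
    rewrite lee_fin.
    apply: (@solution_content_translation _ _ _ _ M_compact PhiP x_uniform x_shadowed
      U W _ _ U_infty W_infty zz zzP u V D T rho) => //.
    move=> z z' Vz zz'; apply: subset_closure; apply: (ED _ _ _ _ _ zz').
    exact: interior_subset Vz.
  apply: (le_trans (nu_closed _ cD)); apply: (le_trans _ (ltW Ge)).
  apply: le_measure => //; apply/mem_set; first exact: borel_closed.
  exact: borel_open.
split.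
  move=> u A mA.
  apply: (@borel_measure_eq _ (pointed_at z0)
    (image_measure nu (borel_continuous (translation_continuous u))) nu) => //.
  - by rewrite /= /pushforward preimage_setT probability_setT.
  - exact: probability_setT.
  move=> C cC; apply/eqP; rewrite eq_le translation_le//=.
  (* The reverse inequality is the same one for the inverse translation. *)
  have := translation_le (- u) (solution_translation u @^-1` C) _.
  have -> : solution_translation (- u) @^-1` (solution_translation u @^-1` C) = C.
    have translationK z : solution_translation u (solution_translation (- u) z) = z.
      by apply/val_inj/funext => s /=; rewrite /translation addrA addNr add0r.
    by apply/seteqP; split => z /=; rewrite translationK.
  apply; apply: closed_comp => // z _; exact: translation_continuous.
have ev_continuous : continuous ((fun z : S => set_val z 0) : pointed_at z0 -> M).
  exact: evaluation_continuous.
move=> A mA; apply/esym.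
apply: (@borel_measure_eq_le _ _
  (image_measure nu (borel_continuous ev_continuous)) mu) => //.
- by rewrite /= /pushforward preimage_setT probability_setT.
- exact: probability_setT.
move=> C cC; apply/lee_addgt0Pr => e e0.
have [r r0 rC] := enlargement_measure_approx (m := mu) (probability_setT mu) cC e0.
apply: le_trans (ltW rC).
apply: le_trans (solution_content_evaluation_le U_infty W_infty zzP C r0 mu_g).
have oV := open_enlargement C (r / 4).
have oeV : open ([set z : pointed_at z0 | enlargement C (r / 4) (set_val (z : S) 0)]).
  by apply: (open_comp (f := fun z : pointed_at z0 => set_val (z : S) 0)) => //
    z _; exact: ev_continuous.
have ceC : closed ([set z : pointed_at z0 | C (set_val (z : S) 0)]).
  by apply: (closed_comp (f := fun z : pointed_at z0 => set_val (z : S) 0)) => //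
    z _; exact: ev_continuous.
apply: le_trans (nu_open _ oeV).
have -> : image_measure nu (borel_continuous ev_continuous) C =
  nu [set z : pointed_at z0 | C (set_val (z : S) 0)] by [].
apply: le_measure.
- by apply/mem_set; exact: borel_closed.
- by apply/mem_set; exact: borel_open.
by move=> z Cz; exists (set_val (z : S) 0) => //; rewrite mdistxx divr_gt0.
Qed.

End occupation_limits.

(** * Recurrence and the Birkhoff center *)

Section recurrence.
Context {d : measure_display} {T : measurableType d} {R : realType}.
Variables (nu : probability T R) (f : nat -> T -> T).
Hypotheses (f_measurable : forall n A, measurable A -> measurable (f n @^-1` A))
  (f_invariant : forall n A, measurable A -> nu (f n @^-1` A) = nu A)
  (f_semigroup : forall m n z, f (m + n) z = f m (f n z)).

(** If W is the set of non-returning points, its preimages under the times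
    that are multiples of N+1 are disjoint and have equal measure. *)
Lemma poincare_recurrence (A : set T) (N : nat) : measurable A ->
  nu.-negligible [set z | A z /\ forall n, (N <= n)%N -> ~ A (f n z)].
Proof.
move=> mA; pose W := A `&` \bigcap_(n in [set n | (N <= n)%N]) ~` (f n @^-1` A).
have mW : measurable W.
  apply: measurableI => //; apply: bigcap_measurable; first by exists N => /=.
  by move=> n _; apply: measurableC; exact: f_measurable.
have -> : [set z | A z /\ forall n, (N <= n)%N -> ~ A (f n z)] = W.
  by apply/seteqP; split => z [Az nA]; split => // n; exact: nA.
(* Multiples of N.+1 rather than N, which may be zero. *)
pose V k := f (k * N.+1)%N @^-1` W.
have mV k : measurable (V k) by exact: f_measurable.
have tV : trivIset setT V.
  apply/trivIsetP => j k _ _; wlog jk : j k / (j < k)%N => [wH|_].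
    rewrite neq_ltn => /orP[jk|kj]; first by apply: wH => //; rewrite neq_ltn jk.
    by rewrite setIC; apply: wH => //; rewrite neq_ltn kj.
  rewrite -subset0 => z [[_ nA] [Az _]].
  apply: (nA ((k - j) * N.+1)%N).
    by rewrite /= mulnS (leq_trans _ (leq_addl _ _))// leq_pmull// subn_gt0.
  by rewrite /= -f_semigroup -mulnDl subnK// ltnW.
apply/negligibleP => //.
have W_fin : nu W \is a fin_num by exact: fin_num_measure.
have nW (n : nat) : n%:R * fine (nu W) <= 1.
  rewrite -lee_fin.
  have <- : nu (\big[setU/set0]_(i < n) V i) = (n%:R * fine (nu W))%:E.
    rewrite measure_bigsetU//.
    rewrite (eq_bigr (fun=> (fine (nu W))%:E)); last first.
      by move=> i _; rewrite fineK//; exact: f_invariant.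
    by rewrite sumEFin sumr_const card_ord mulr_natl.
  by apply: probability_le1; exact: bigsetU_measurable.
have W_le0 : fine (nu W) <= 0.
  rewrite leNgt; apply/negP => w0; have := nW (Num.truncn (fine (nu W))^-1).+1.
  by rewrite -ler_pdivlMr// div1r leNgt truncnS_gt.
have nuW_le0 : (nu W <= 0)%E by rewrite -(fineK W_fin) lee_fin.
by apply/eqP; rewrite eq_le measure_ge0 andbT.
Qed.

End recurrence.

Section support.
Context {R : realType} {M : pmetricType R}.
Variable (Phi : R -> M -> set M).
Hypothesis (M_compact : compact [set: M]).
Notation S := (entire_solutions Phi).

(** Returning infinitely often, at integer times, to every basic
    neighborhood of its starting point puts this point in the limit set. *)
Lemma recurrent_solution (V : nat -> set M) (z : S) :
  (forall y B, nbhs y B -> exists i, V i y /\ V i `<=` B) ->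
  (forall i N, V i (set_val z 0) ->
    exists2 n : nat, (N <= n)%N & V i (set_val z n%:R)) ->
  recurrent_points Phi (set_val z 0).
Proof.
move=> V_base z_returns; exists (set_val z).
  by split => //; exact: set_valP.
move=> t /= t0 B /V_base[i [Viz ViB]].
have [n nt Vizn] := z_returns i (Num.truncn t).+1 Viz.
exists (set_val z n%:R); split; last exact: ViB.
exists n%:R => //=; rewrite ltW//; apply: (lt_le_trans (truncnS_gt t)).
by rewrite ler_nat.
Qed.

Lemma compact_countable_base : exists V : nat -> set M, (forall i, open (V i)) /\
  forall y B, nbhs y B -> exists i, V i y /\ V i `<=` B.
Proof.
have [D D_countable [D_open D_base]] := compact_second_countable M_compact.
have [D0|[f]] := pfcard_geP D_countable.
  have [U [+ _]] := D_base point _ (@filterT _ (nbhs point) _).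
  by rewrite D0.
exists f; split => [i|y B /D_base[U [DU Uy] UB]].
  by apply: D_open; exact: funS.
by have [i _ fiU] := 'surj_f DU; exists i; rewrite fiU.
Qed.

(** By Poincare recurrence for the sets of a countable base, almost every
    solution returns to every basic neighborhood of its starting point,
    hence starts at a recurrent point. An open set charged by mu is
    therefore met by such starting points. *)
Lemma measure_support_invariant (mu : probability (borel M) R) :
  invariant_measures Phi mu -> measure_support mu `<=` birkhoff_center Phi.
Proof.
move=> [z0 [nu [nu_inv muE]]] x xmu B.
rewrite nbhsE => -[U [oU Ux] UB].
have [V [V_open V_base]] := compact_countable_base.
have ev_continuous : continuous ((fun z : S => set_val z 0) : pointed_at z0 -> M).
  exact: evaluation_continuous.
have oev (G : set M) : open G -> open ([set z : pointed_at z0 | G (set_val (z : S) 0)]).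
  by move=> oG; apply: (open_comp (f := fun z : pointed_at z0 => set_val (z : S) 0)) => //
    z _; exact: ev_continuous.
pose f (n : nat) : pointed_at z0 -> pointed_at z0 := solution_translation n%:R.
have f_measurable n A : measurable (A : set (borel (pointed_at z0))) ->
    measurable (f n @^-1` A : set (borel (pointed_at z0))).
  move=> mA; have : continuous (f n) by exact: solution_translation_continuous.
  by move=> /borel_continuous/(_ measurableT A mA); rewrite setTI.
have f_semigroup m n z : f (m + n)%N z = f m (f n z).
  apply/val_inj/funext => s /=; rewrite /translation natrD addrA.
  by rewrite [n%:R + m%:R]addrC.
pose A i := [set z : pointed_at z0 | V i (set_val (z : S) 0)].
pose N := \bigcup_i \bigcup_n [set z | A i z /\ forall k, (n <= k)%N -> ~ A i (f k z)].
have N_negligible : (nu : probability (borel (pointed_at z0)) R).-negligible N.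
  apply: negligible_bigcup => i; apply: negligible_bigcup => n.
  apply: (@poincare_recurrence _ (borel (pointed_at z0)) R nu f) => //.
  - by move=> k C; exact: nu_inv.
  - by apply: borel_open; exact: oev.
have [z [Uz Nz]] : exists z : S, U (set_val z 0) /\ ~ N z.
  apply: contrapT => H; have UN : [set z : S | U (set_val z 0)] `<=` N.
    by move=> z Uz; apply: contrapT => Nz; apply: H; exists z.
  have mU : measurable ([set z : pointed_at z0 | U (set_val (z : S) 0)] :
      set (borel (pointed_at z0))).
    by apply: borel_open; exact: oev.
  have : nu [set z : S | U (set_val z 0)] = 0%E.
    by apply/(negligibleP _ mU); exact: negligibleS N_negligible.
  have := xmu U oU Ux; rewrite muE; last exact: borel_open.
  by move=> /[swap] ->; rewrite ltxx.
exists (set_val z 0); split; last exact: UB.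
apply: (recurrent_solution V_base) => i n Viz.
apply: contrapT => H; apply: Nz; exists i => //; exists n => //; split => // k nk Ak.
by apply: H; exists k => //; rewrite -[k%:R]addr0; exact: Ak.
Qed.

End support.

(** * The almost sure statement *)

Lemma shadowed_le {R : realType} {M : pmetricType R} (Phi : R -> M -> set M)
    (T J : nat) (e e' : R) (y : R -> M) : e <= e' ->
  shadowed Phi T J e y -> shadowed Phi T J e' y.
Proof.
by move=> ee' [z Sz zy]; exists z => // j jT; exact: lt_le_trans (zy j jT) ee'.
Qed.

Theorem theorem3p2 (R : realType) (M : pmetricType R)
    (Phi : R -> M -> set M)
    (d : measure_display) (Omega : measurableType d)
    (P : probability Omega R) (F : R -> set (set Omega))
    (X : R -> Omega -> M) :
  compact [set: M] -> is_svds Phi -> is_filtration F -> is_wapt P F Phi X ->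
  {ae P, forall w, occupation_limits (X ^~ w) `<=` invariant_measures Phi} /\
  {ae P, forall w, \bigcup_(mu in occupation_limits (X ^~ w)) measure_support mu
                     `<=` birkhoff_center Phi}.
Proof.
move=> M_compact PhiP FP XP.
have invariant : {ae P, forall w, occupation_limits (X ^~ w) `<=` invariant_measures Phi}.
  have : {ae P, forall w, forall m T J l : nat, null_density [set k |
      ~ shadowed Phi T.+1 J l.+1%:R^-1 (fun s => X (k%:R / m.+1%:R + s) w)]}.
    do 4!apply: ae_foralln => ?.
    exact: (wapt_shadowed M_compact PhiP FP XP).
  apply: filterS2 (wapt_uniformly_continuous XP) => w w_uniform w_shadowed.
  apply: (occupation_limit_invariant M_compact PhiP w_uniform).
  move=> m [//|T] J e _ e0.
  have [l _ /(_ l (leqnn l)) /= le] := near_infty_natSinv_lt (PosNum e0).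
  apply: null_density_sub (w_shadowed m T J l) => k /= nsh sh; apply: nsh.
  exact: shadowed_le (ltW le) sh.
split => //; apply: filterS invariant => w inv x [mu /inv mu_inv mux].
exact: measure_support_invariant mu_inv _ mux.
Qed.
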